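(* Let $n\ge 1$ and let $G^\star=([n],E^\star)$ be a directed graph (directed cycles allowed), and assume the available conditional independence statements are exactly the $d$-separation statements of $G^\star$. Equip $\mathbb{Z}^{n+2}$ with the lexicographic order. Then each minimizer of the graphical score $\mathrm{score}(\mathcal P,\pi)$ over the set $\mathcal S$ of partially ordered partitions of $[n]$ uniquely determines the Markov equivalence class of $G^\star$.
   Context: Setting: $[n]=\{1,\dots,n\}$. The observed distribution $\mathbb P$ is Markov and faithful to $G^\star$; for distinct $a,b\in[n]$ and $Z\subseteq[n]\setminus\{a,b\}$ write $a\perp\!\!\!\perp b\mid Z$ if $a$ and $b$ are $d$-separated given $Z$ in $G^\star$ (equivalently $X_a\perp\!\!\!\perp X_b\mid X_Z$ under $\mathbb P$), and $a\not\perp\!\!\!\perp b\mid Z$ otherwise. In a directed graph, $a$ is an ancestor of $b$ (and $b$ a descendant of $a$) if $a=b$ or there is a directed path from $a$ to $b$. Two directed graphs on $[n]$ are Markov equivalent if they satisfy the same $d$-separation statements. Partially ordered partitions: $\mathcal S$ is the set of pairs $(\mathcal P,\pi)$ with $\mathcal P$ a partition of $[n]$ and $\pi\subseteq\mathcal P\times\mathcal P$ a partial order on $\mathcal P$; write $C_1\le_\pi C_2$ iff $(C_1,C_2)\in\pi$. $C_{i,\mathcal P}$ denotes the block of $\mathcal P$ containing $i$. For blocks $C,C_1,\dots,C_t$, write $C\le_\pi\max\{C_1,\dots,C_t\}$ iff $C\le_\pi C_i$ for some $i$. For $(\mathcal P,\pi)\in\mathcal S$ define: $E^{(1)}_{(\mathcal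 P,\pi)}=\{(a,b)\in[n]^2: a\ne b,\ a\not\perp\!\!\!\perp b\mid \bigcup\{C\in\mathcal P: C\le_\pi\max\{C_{a,\mathcal P},C_{b,\mathcal P}\}\}\setminus\{a,b\}\}$. $E^{(2)}_{(\mathcal P,\pi)}$: triples $(a,b,c)\in[n]^3$ of distinct elements with $(a,b),(c,b)\in E^{(1)}_{(\mathcal P,\pi)}$, $(a,c)\notin E^{(1)}_{(\mathcal P,\pi)}$, and $C_{b,\mathcal P}\le_\pi\max\{C_{a,\mathcal P},C_{c,\mathcal P}\}$. $E^{(3)}_{(\mathcal P,\pi)}$: triples $(a,b,c)$ of distinct elements with $(a,b),(c,b)\in E^{(1)}_{(\mathcal P,\pi)}$, $(a,c)\notin E^{(1)}_{(\mathcal P,\pi)}$, and $a\not\perp\!\!\!\perp c\mid\bigcup\{C\in\mathcal P: C\le_\pi\max\{C_{a,\mathcal P},C_{b,\mathcal P},C_{c,\mathcal P}\}\}\setminus\{a,c\}$. $E^{(4)}_{(\mathcal P,\pi)}$: pairs $((a,b_1,c),(a,b_2,c))$ with $a,b_1,c$ distinct, $a,b_2,c$ distinct, $(a,b_1),(c,b_1),(a,b_2),(c,b_2)\in E^{(1)}_{(\mathcal P,\pi)}$, $(a,c)\notin E^{(1)}_{(\mathcal P,\pi)}$, $(a,b_1,c),(a,b_2,c)\notin E^{(2)}_{(\mathcal P,\pi)}\cup E^{(3)}_{(\mathcal P,\pi)}$, and $C_{b_1,\mathcal P}\le_\pi C_{b_2,\mathcal P}$. For $t\in\{1,\dots,n-2\}$,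 $D^{(t)}_{(\mathcal P,\pi)}$: tuples $(a_0,\dots,a_{t+1})\in[n]^{t+2}$ of distinct elements with $(a_i,a_{i+1})\in E^{(1)}_{(\mathcal P,\pi)}$ for all $i\in\{0,\dots,t\}$, $(a_i,a_j)\notin E^{(1)}_{(\mathcal P,\pi)}$ for all $i\in\{2,\dots,t+1\}$, $j\in\{0,\dots,i-2\}$, $C_{a_1,\mathcal P}=\dots=C_{a_t,\mathcal P}$, and not $C_{a_1,\mathcal P}\le_\pi\max\{C_{a_0,\mathcal P},C_{a_{t+1},\mathcal P}\}$. $E^{(6)}_{(\mathcal P,\pi)}=\bigcup_{t=1}^{n-2}\{((a_0,\dots,a_{t+1}),(a_0,b,a_{t+1})): a_0,b,a_{t+1}$ distinct, $(a_0,b),(a_{t+1},b)\in E^{(1)}_{(\mathcal P,\pi)}$, $(a_0,b,a_{t+1})\notin E^{(2)}_{(\mathcal P,\pi)}\cup E^{(3)}_{(\mathcal P,\pi)}$, $(a_0,\dots,a_{t+1})\in D^{(t)}_{(\mathcal P,\pi)}$, $C_{a_1,\mathcal P}\le_\pi C_{b,\mathcal P}\}$. The graphical score is $\mathrm{score}(\mathcal P,\pi)=(|E^{(1)}|,|E^{(2)}|,|E^{(3)}|,|E^{(4)}|,-|D^{(2)}|,\dots,-|D^{(n-2)}|,|E^{(6)}|)\in\mathbb Z^{n+2}$ (all sets indexed by $(\mathcal P,\pi)$), compared lexicographically.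
   Formalization: A minimizer alone does not fix the class (n=2: edge vs. no edge); the formal claim is that a minimizer together with its sets E(1),...,E(4), D(t), E(6) does: two graphs sharing a minimizer and these sets are Markov equivalent. *)

(* Defs.v *)
From HB Require Import structures.
From mathcomp Require Import all_boot all_order all_algebra.
From mathcomp Require Import boolp.

Set Implicit Arguments.
Unset Strict Implicit.
Unset Printing Implicit Defensive.

Import GRing.Theory Num.Theory.

(* Vertices: [n] is modelled by 'I_n (0-indexed).
   A directed graph (self-loops / directed cycles allowed) is a relation
   G : rel 'I_n, with G u v meaning the edge u -> v. *)

Section DSep.
Variable n : nat.
Local Notation T := 'I_n.
Variable G : rel T.

Definition ancestor (u v : T) : bool := connect G u v.

(* A d-connecting path from a to b given Z: a path  p = a :: q  with pairwise
   distinct vertices, ending at b, together with a choice of edge orientations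
   d (d_i = true means p_i -> p_{i+1}, false means p_{i+1} -> p_i, and the
   chosen edge must exist in G), such that every interior collider is an
   ancestor of some vertex of Z and every interior non-collider is not in Z. *)
Definition dconnected (Z : {set T}) (a b : T) : Prop :=
  exists (q : seq T) (d : seq bool),
    [/\ uniq (a :: q), last a q = b, size d = size q,
        (forall i, i < size q ->
           let u := nth a (a :: q) i in
           let v := nth a (a :: q) i.+1 in
           if nth false d i then G u v else G v u) &
        (forall i, 0 < i < size q ->
           let c := nth a (a :: q) i in
           if nth false d i.-1 && ~~ nth false d i
           then [exists z in Z, ancestor c z]
           else c \notin Z)].

Definition dsep (Z : {set T}) (a b : T) : Prop := ~ dconnected Z a b.

End DSep.

Definition markov_equiv (n : nat) (G1 G2 : rel 'I_n) : Prop :=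
  forall (a b : 'I_n) (Z : {set 'I_n}),
    a != b -> a \notin Z -> b \notin Z -> (dsep G1 Z a b <-> dsep G2 Z a b).

Section Score.
Variable n : nat.
Local Notation T := 'I_n.
Variable G : rel T.
Variable P : {set {set T}}.
Variable pi : {set ({set T} * {set T})}.

Definition is_popartition : bool :=
  [&& partition P [set: T],
      pi \subset setX P P,
      [forall C in P, (C, C) \in pi],
      [forall C1, forall C2, ((C1, C2) \in pi) && ((C2, C1) \in pi) ==> (C1 == C2)] &
      [forall C1, forall C2, forall C3,
         ((C1, C2) \in pi) && ((C2, C3) \in pi) ==> ((C1, C3) \in pi)]].

Definition blk (i : T) : {set T} := pblock P i.
Definition ple (C C' : {set T}) : bool := (C, C') \in pi.
Definition plemax (C : {set T}) (Cs : seq {set T}) : bool := has (ple C) Cs.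

Definition below (Cs : seq {set T}) (R : {set T}) : {set T} :=
  (\bigcup_(C in P | plemax C Cs) C) :\: R.

Definition ndep (Z : {set T}) (a b : T) : bool := `[< dconnected G Z a b >].

Definition E1 : {set T * T} :=
  [set ab | (ab.1 != ab.2) &&
            ndep (below [:: blk ab.1; blk ab.2] [set ab.1; ab.2]) ab.1 ab.2].

Definition distinct3 (a b c : T) : bool := [&& a != b, b != c & a != c].

Definition vbase (x : T * T * T) : bool :=
  let: (a, b, c) := x in
  [&& distinct3 a b c, (a, b) \in E1, (c, b) \in E1 & (a, c) \notin E1].

Definition E2 : {set T * T * T} :=
  [set x | vbase x &&
     (let: (a, b, c) := x in plemax (blk b) [:: blk a; blk c])].

Definition E3 : {set T * T * T} :=
  [set x | vbase x &&
     (let: (a, b, c) := x in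
      ndep (below [:: blk a; blk b; blk c] [set a; c]) a c)].

Definition E4 : {set (T * T * T) * (T * T * T)} :=
  [set xy | let: ((a, b1, c), (a', b2, c')) := xy in
     [&& a' == a, c' == c, vbase (a, b1, c), vbase (a, b2, c),
         (a, b1, c) \notin E2 :|: E3, (a, b2, c) \notin E2 :|: E3 &
         ple (blk b1) (blk b2)]].

Definition Dpred (t : nat) (s : (t.+2).-tuple T) : bool :=
  let x := fun i => nth (thead s) s i in
  [&& uniq s,
      [forall i : 'I_t.+1, (x i, x i.+1) \in E1],
      [forall i : 'I_t.+2, forall j : 'I_t.+2,
         (2 <= i) && (j <= i - 2) ==> ((x i, x j) \notin E1)],
      [forall i : 'I_t.+1, (1 <= i) ==> (blk (x i) == blk (x 1))] &
      ~~ plemax (blk (x 1)) [:: blk (x 0); blk (x t.+1)]].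

Definition Dset (t : nat) : {set (t.+2).-tuple T} := [set s | Dpred s].

Definition E6t (t : nat) : {set (t.+2).-tuple T * (T * T * T)} :=
  [set sy : (t.+2).-tuple T * (T * T * T) |
     let: (s, (a0, b, at1)) := sy in
     let x := fun i => nth a0 s i in
     [&& a0 == x 0, at1 == x t.+1,
         distinct3 a0 b at1, (a0, b) \in E1, (at1, b) \in E1,
         (a0, b, at1) \notin E2 :|: E3, Dpred s &
         ple (blk (x 1)) (blk b)]].

(* |E^(6)| : E^(6) is the disjoint union over t = 1..n-2 of the slices. *)
Definition cardE6 : nat := \sum_(1 <= t < n.-1) #|E6t t|.

Definition score : seq int :=
  [:: (#|E1| : int); (#|E2| : int); (#|E3| : int); (#|E4| : int)]
  ++ [seq (- (#|Dset t| : int))%R | t <- iota 2 (n - 3)]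
  ++ [:: (cardE6 : int)].

End Score.

Fixpoint lexle (s t : seq int) : bool :=
  match s, t with
  | [::], _ => true
  | _ :: _, [::] => false
  | x :: s', y :: t' => (x < y)%R || ((x == y) && lexle s' t')
  end.

Definition is_minimizer (n : nat) (G : rel 'I_n)
    (P : {set {set 'I_n}}) (pi : {set ({set 'I_n} * {set 'I_n})}) : Prop :=
  is_popartition P pi /\
  forall (P' : {set {set 'I_n}}) (pi' : {set ({set 'I_n} * {set 'I_n})}),
    is_popartition P' pi' -> lexle (score G P pi) (score G P' pi').

Definition same_score_data (n : nat) (G1 G2 : rel 'I_n)
    (P : {set {set 'I_n}}) (pi : {set ({set 'I_n} * {set 'I_n})}) : Prop :=
  [/\ E1 G1 P pi = E1 G2 P pi /\ E2 G1 P pi = E2 G2 P pi,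
      E3 G1 P pi = E3 G2 P pi,
      E4 G1 P pi = E4 G2 P pi,
      (forall t, 1 <= t <= n - 2 -> Dset G1 P pi t = Dset G2 P pi t) &
      (forall t, 1 <= t <= n - 2 -> E6t G1 P pi t = E6t G2 P pi t)].

(* Main.v *)
Require Import Defs.
From mathcomp Require Import all_boot all_order all_algebra.
From mathcomp Require Import boolp zify.

(** Write [u ~ v] for p-adjacency: no set separates [u] and [v].  Separation of [a] and [b]
    by [Z] is separation in the moral graph of the ancestors of [a], [b] and [Z].  The
    partition into strong components, ordered by ancestry, has a score whose components
    other than the [D] sets are contained in those of any competitor that ties on the
    earlier ones, while its [D] sets contain them; hence every minimizer has exactly its
    score data.

    Given two graphs with the same data, let [A] be ancestral in [G2] and suppose two
    members [u], [v] of [A] are joined in the moral graph of [G1] through vertices outside [A]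
    that are ancestors of [A] in [G1].  Among the [~]-walks from [u] to [v] of this kind take
    one minimizing the sum of [2 ^ d], where [d] is the distance to [A] along [~]-paths
    ascending in [G1].  It is uncovered, so (as its interior is not below its ends in [G2])
    it contains a path counted by [D], which belongs to both graphs.  Follow a shortest
    ascending path from there to some [z] in [A]: either it offers a cheaper detour, or both
    ends of the [D]-path are adjacent to [z], and then [E3] and [E6] force [u] and [v] to be
    adjacent in the moral graph of [A] in [G2].  So a connection in [G1] becomes one in [G2],
    and the theorem follows by symmetry. *)

Set Implicit Arguments.
Unset Strict Implicit.
Unset Printing Implicit Defensive.

(** * Moralization *)

Section MoralGraph.
Variable n : nat.
Local Notation T := 'I_n.
Variable G : rel T.
Implicit Types (Z A S : {set T}) (a b u v x y : T).

Definition anc_set S : {set T} := [set x | [exists y in S, connect G x y]].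

Definition moral A : rel T :=
  fun u v => [|| G u v, G v u | [exists c in A, G u c && G v c]].

Definition moral_off A Z : rel T :=
  fun u v => [&& u \in A :\: Z, v \in A :\: Z & moral A u v].

(* A state (v, d) is a visit of v by a walk, d telling whether the walk entered v
   along an edge pointing into v. *)
Definition dstep Z : rel (T * bool) := fun s t =>
  (if t.2 then G s.1 t.1 else G t.1 s.1) &&
  (if s.2 && ~~ t.2 then s.1 \in anc_set Z else s.1 \notin Z).

Lemma anc_setP S x : reflect (exists2 y, y \in S & connect G x y) (x \in anc_set S).
Proof. by rewrite inE; apply: exists_inP. Qed.

Lemma mem_anc_set S x : x \in S -> x \in anc_set S.
Proof. by move=> xS; apply/anc_setP; exists x. Qed.

Lemma anc_set_closed S x y : connect G x y -> y \in anc_set S -> x \in anc_set S.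
Proof.
move=> xy /anc_setP[z zS yz]; apply/anc_setP; exists z => //.
exact: connect_trans xy yz.
Qed.

Lemma anc_setS S S' : S \subset S' -> anc_set S \subset anc_set S'.
Proof.
move/subsetP=> SS'; apply/subsetP=> x /anc_setP[y yS xy].
by apply/anc_setP; exists y => //; apply: SS'.
Qed.

Lemma anc_set_id A :
  (forall x y, connect G x y -> y \in A -> x \in A) -> anc_set A = A.
Proof.
move=> clA; apply/setP=> x; apply/idP/idP; last exact: mem_anc_set.
by case/anc_setP=> y yA xy; apply: clA xy yA.
Qed.

Lemma moral_sym A : symmetric (moral A).
Proof.
move=> u v; rewrite /moral orbCA; congr [|| _, _ | _].
by apply: eq_existsb => c; rewrite [G u c && _]andbC.
Qed.

Lemma moralS A A' u v : A \subset A' -> moral A u v -> moral A' u v.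
Proof.
move=> /subsetP sA /or3P[uv | uv | /exists_inP[c cA uvc]]; try by rewrite /moral uv ?orbT.
by apply/or3P; apply: Or33; apply/exists_inP; exists c => //; apply: sA.
Qed.

(** The first turn from a forward to a backward step is an open collider, which is a descendant of
    [x] and an ancestor of [Z]. *)
Lemma dstep_into_anc Z p x s :
  path (dstep Z) (x, true) (rcons p s) -> ~~ s.2 -> x \in anc_set Z.
Proof.
elim: p x => [|[y d] p IH] x /=.
  by case: s => y [] //=; rewrite andbT => /andP[_ xZ] _.
case/andP=> /andP[/= xy xZ] pth ns; case: d xy xZ pth => //= xy xZ pth.
apply: (@anc_set_closed _ _ y); first exact: connect1.
exact: IH pth ns.
Qed.

(** Excises a loop at [v]. If [v] becomes a collider, the loop starts at an arrowhead and ends with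
    a backward step, so [dstep_into_anc] applies; if it stops being one, the first step of the loop
    already required [v] outside [Z]. *)
Lemma dstep_cut Z v d1 d2 p2 w e :
  path (dstep Z) (v, d1) (rcons p2 (v, d2)) -> dstep Z (v, d2) (w, e) ->
  dstep Z (v, d1) (w, e).
Proof.
move=> pth /andP[/= vw cond]; apply/andP; split=> //=.
case: e d1 d2 cond pth vw => [] [] [] //= cond pth _.
- exact: dstep_into_anc pth _.
- by case: p2 pth => [|[y []] p2] /= /andP[/andP[_ ?] _].
Qed.

Lemma dstep_path_uniq Z a b p : path (dstep Z) (a, false) p ->
  (last (a, false) p).1 = b ->
  exists p', [/\ path (dstep Z) (a, false) p', (last (a, false) p').1 = b &
                 uniq (a :: map fst p')].
Proof.
have [m] := ubnP (size p); elim: m p => // m IH p; rewrite ltnS => szp pth lst.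
have [/= ?|] := boolP (uniq (map fst ((a, false) :: p))); first by exists p.
case/(uniqPn a) => i [j []]; rewrite size_map => ij jsz.
set s := (a, false) :: p in jsz *.
have isz : i < size s by apply: ltn_trans jsz.
rewrite !(nth_map (a, false)) // => eqij.
have cut k : k < size s -> s = take k s ++ nth (a, false) s k :: drop k.+1 s.
  by move=> ksz; rewrite -drop_nth // cat_take_drop.
case E1: (nth (a, false) s i) eqij => [v d1] /=.
case E2: (nth (a, false) s j) => [v' d2] /= E3; subst v'.
have pths k : k < size s -> path (dstep Z) (nth (a, false) s k) (drop k.+1 s).
  case: k => [|k] ksz /=; first by rewrite drop0.
  move: pth; rewrite -{1}[p](cat_take_drop k) cat_path => /andP[_].
  by rewrite (drop_nth (a, false)) //= => /andP[].
have lsts k : k < size s -> (last (nth (a, false) s k) (drop k.+1 s)).1 = b.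
  case: k => [|k] ksz /=; first by rewrite drop0.
  by move: lst; rewrite -{1}[p](cat_take_drop k) last_cat (drop_nth (a, false)).
have mid : path (dstep Z) (v, d1) (rcons (take (j - i.+1) (drop i.+1 s)) (v, d2)).
  move: (pths i isz); rewrite E1 -{1}[drop i.+1 s](cat_take_drop (j - i.+1)) cat_path.
  case/andP=> P1; rewrite drop_drop subnK // (drop_nth (a, false) jsz) E2 /= => /andP[P2 _].
  by rewrite rcons_path P1.
have tl : path (dstep Z) (v, d1) (drop j.+1 s).
  move: (pths j jsz); rewrite E2; case: (drop j.+1 s) => //= [[w e] r] /andP[vw ->].
  by rewrite (dstep_cut mid vw).
have tll : (last (v, d1) (drop j.+1 s)).1 = b.
  by move: (lsts j jsz); rewrite E2; case: (drop j.+1 s).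
case: i ij isz E1 {cut} mid => [|i] ij isz E1 mid.
  move: E1 tl tll => /= [<- <-] tl tll; apply: (IH (drop j.+1 s)) => //.
  by apply: leq_trans szp; rewrite /s /= size_drop; rewrite /s /= in jsz; lia.
apply: (IH (take i p ++ (v, d1) :: drop j.+1 s)).
- apply: leq_trans szp; rewrite size_cat /= size_drop size_take /=.
  rewrite /s /= in isz jsz *; rewrite ltnS in isz; rewrite isz; lia.
- rewrite cat_path /= tl andbT.
  have := pth; rewrite -{1}[p](cat_take_drop i) cat_path => /andP[-> /=].
  by rewrite (drop_nth (a, false)) //= /= in E1 *; rewrite E1 => /andP[].
- by rewrite last_cat /=.
Qed.

(** A path with its orientations is a walk through states; conversely cutting loops makes the
    vertices distinct. The start direction [false] keeps [a] from counting as a collider. *)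
Lemma dconnected_dstep Z a b : a \notin Z ->
  dconnected G Z a b <-> exists e, connect (dstep Z) (a, false) (b, e).
Proof.
move=> aZ; split=> [[q [d [_ lst szd edges cond]]]|[e /connectP[p pth lst]]].
  exists (last false d); apply/connectP; exists (zip q d); last first.
    rewrite -lst; elim: q d szd a false {lst edges cond aZ} => [|x q IH] [|f d] //= [szd] y g.
    exact: IH.
  apply/(pathP (a, false)) => i; rewrite size_zip szd minnn => isz.
  rewrite -[_ :: zip q d]/(zip (a :: q) (false :: d)) !nth_zip //= ?szd // /dstep /=.
  have /= -> := edges i isz; case: i isz => [|i] isz /=; first by rewrite aZ.
  by have := cond i.+1 isz; rewrite inE.
have [p' [pth' lst' unq]] := dstep_path_uniq pth (esym (congr1 fst lst)).
exists (map fst p'), (map snd p'); split=> //.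
- by have := last_map fst p' (a, false) => /= ->; rewrite lst'.
- by rewrite !size_map.
- move=> i; rewrite size_map => isz /=.
  have /(pathP (a, false))/(_ i isz) := pth'; rewrite /dstep.
  have /= <- : nth a (map fst ((a, false) :: p')) i = (nth (a, false) ((a, false) :: p') i).1.
    by apply: nth_map; apply: ltnW.
  by rewrite !(nth_map (a, false)) // => /andP[].
- case=> // i; rewrite size_map => isz /=.
  have /(pathP (a, false))/(_ i.+1 isz) := pth'.
  rewrite !(nth_map (a, false)) //= ?(ltnW isz) // /dstep => /andP[_].
  by rewrite inE.
Qed.

Section Endpoints.
Variables (Z : {set T}) (a b : T).
Hypotheses (aZ : a \notin Z) (bZ : b \notin Z).
Let A := anc_set (a |: (b |: Z)).
Let Zab : Z \subset a |: (b |: Z).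
Proof. by apply/subsetP=> z zZ; rewrite !inE zZ !orbT. Qed.
Let ZA x : x \in anc_set Z -> x \in A.
Proof. exact/subsetP/anc_setS. Qed.
Let aA x : connect G x a -> x \in A.
Proof. by move=> xa; apply/anc_setP; exists a => //; rewrite !inE eqxx. Qed.
Let bA x : connect G x b -> x \in A.
Proof. by move=> xb; apply/anc_setP; exists b => //; rewrite !inE eqxx orbT. Qed.

Lemma dstep_to_anc p x e : path (dstep Z) (x, true) p ->
  last (x, true) p = (b, e) -> x \in A.
Proof.
elim: p x => [|[y d] p IH] x /= => [_ [-> _]|/andP[/andP[/= xy cond] pth] lst].
  exact: bA.
case: d xy cond pth lst => //= xy cond pth lst; last exact: ZA.
by apply: anc_set_closed (connect1 xy) _; apply: IH lst.
Qed.

Lemma dstep_from_anc p x : path (dstep Z) (a, false) p ->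
  last (a, false) p = (x, false) -> x \in A.
Proof.
elim/last_ind: p x => [|p [y d] IH] x /= => [_ [<-]|]; first exact: aA.
rewrite rcons_path last_rcons => /andP[pth st] [<- d0]; subst d.
case E: (last (a, false) p) st => [v dv] /andP[/= yv cond].
apply: anc_set_closed (connect1 yv) _.
by case: dv E cond => /= E cond; [apply: ZA | apply: IH E].
Qed.

(** A vertex entered by an arrowhead leads down to [b] or to an open collider, any other traces back
    to [a] or to an open collider; so the walk stays in [A]. *)
Lemma dstep_moral p e : path (dstep Z) (a, false) p -> last (a, false) p = (b, e) ->
  connect (moral_off A Z) a b.
Proof.
pose R x := connect (moral_off A Z) a x.
(* A vertex of [Z] cannot be reached in the moral graph; a reached parent of it is remembered
   instead, to be married to the vertex that follows the collider. *)
suff inv p1 p2 v dv : path (dstep Z) (a, false) (p1 ++ p2) ->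
    last (a, false) (p1 ++ p2) = (b, e) -> last (a, false) p1 = (v, dv) ->
    v \in A /\ (v \notin Z -> R v) /\
    (dv -> exists u, [/\ u \in A, u \notin Z, R u & G u v]).
  move=> pth lst; have := inv p [::] b e; rewrite !cats0 => /(_ pth lst lst).
  by case=> _ [/(_ bZ)].
elim/last_ind: p1 p2 v dv => [|p1 [w dw] IH] p2 v dv pth lst.
  by case=> <- <-; split=> //; [exact: aA | split=> // _; exact: connect0].
rewrite last_rcons => -[wv dwv]; subst w dw.
move: pth lst; rewrite cat_rcons => pth lst.
case E: (last (a, false) p1) => [u du].
have [uA [Ru Ru']] := IH _ _ _ pth lst E.
have [st pth1 pth2] : [/\ dstep Z (u, du) (v, dv), path (dstep Z) (a, false) (rcons p1 (v, dv))
    & path (dstep Z) (v, dv) p2].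
  by move: pth; rewrite cat_path /= rcons_path E => /and3P[-> -> ->].
have vA : v \in A.
  case: dv st pth1 pth2 pth lst => [_ _ pth2 _ lst|_ pth1 _ _ _].
    by apply: (dstep_to_anc pth2 (e := e)); move: lst; rewrite last_cat.
  by apply: dstep_from_anc pth1 _; rewrite last_rcons.
split=> //; move: st => /andP[/= uv cond].
have Rstep x y : x \in A -> x \notin Z -> y \in A -> y \notin Z -> R x -> moral A x y -> R y.
  move=> ? xZ ? yZ Rx xy; apply: connect_trans Rx _; apply: connect1.
  by apply/and3P; split=> //; apply/setDP.
have [uZ|uZ] := boolP (u \in Z).
  rewrite uZ /= in cond; case: du dv Ru' uv cond {pth pth1 pth2 lst E} => [] [] //= Ru' uv cond.
  split=> // vZ; have [//|x [xA xZ Rx xu]] := Ru'.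
  apply: (Rstep x) => //; apply/or3P; apply: Or33; apply/exists_inP; exists u => //.
  by rewrite xu.
have {Ru} Ru := Ru uZ; split=> [vZ|dvT].
  apply: (Rstep u) => //; apply/or3P.
  by case: dv uv {cond pth pth1 pth2 lst} => uv; [exact: Or31 | exact: Or32].
by exists u; rewrite dvT in uv; split.
Qed.

Let reach x d := connect (dstep Z) (a, false) (x, d).

(** A directed path from [x] to [a] avoids [Z], so it can be walked upwards from [a]. *)
Lemma reach_back x : x \notin anc_set Z -> connect G x a -> reach x false.
Proof.
move=> xZ /connectP[p]; elim: p x xZ => [|y p IH] x xZ /= => [_ <-|/andP[xy pth] lst].
  exact: connect0.
have yZ : y \notin anc_set Z by apply: contra xZ; apply: anc_set_closed (connect1 xy).
apply: connect_trans (IH y yZ pth lst) (connect1 _); rewrite /dstep /= xy /=.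
by apply: contra yZ; apply: mem_anc_set.
Qed.

Lemma reach_forward x d : x \notin anc_set Z -> connect G x b -> reach x d ->
  exists e, reach b e.
Proof.
move=> xZ /connectP[p]; elim: p x d xZ => [|y p IH] x d xZ /= => [_ -> ?|/andP[xy pth] lst rx].
  by exists d.
have yZ : y \notin anc_set Z by apply: contra xZ; apply: anc_set_closed (connect1 xy).
apply: (IH y true) => //; apply: connect_trans rx (connect1 _); rewrite /dstep /= xy andbF /=.
by apply: contra xZ; apply: mem_anc_set.
Qed.

(** A moral edge cannot be walked directly if it makes a collider of a vertex outside [anc_set Z].
    That vertex is an ancestor of [a] or [b]: it is re-entered from [a] without an arrowhead, or the
    walk descends from it straight to [b]. *)
Lemma moral_reach : connect (moral_off A Z) a b -> exists e, reach b e.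
Proof.
case/connectP=> p pth lst.
suff: (exists e, reach b e) \/ exists d, reach (last a p) d by rewrite -lst; case.
elim/last_ind: p pth {lst} => [_|p y IH].
  by right; exists false; apply: connect0.
rewrite rcons_path last_rcons => /andP[/IH[|[d rx]] {IH}]; first by left.
set x := last a p in rx * => /and3P[/setDP[xA xZ] /setDP[yA yZ] xy].
case/or3P: xy => [xy | yx | /exists_inP[c cA /andP[xc yc]]].
- right; exists true; apply: connect_trans rx (connect1 _).
  by rewrite /dstep /= xy andbF.
- have [xanc|xanc] := boolP (x \in anc_set Z).
    right; exists false; apply: connect_trans rx (connect1 _).
    by rewrite /dstep /= yx xanc xZ; case: d.
  have step : reach x false -> exists d, reach y d.
    move=> rx'; exists false; apply: connect_trans rx' (connect1 _).
    by rewrite /dstep /= yx xZ.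
  case/anc_setP: xA => t; rewrite !inE => /or3P[/eqP->|/eqP->|tZ] xt.
  + by right; apply: step; apply: reach_back.
  + by left; apply: reach_forward rx.
  + by case/negP: xanc; apply/anc_setP; exists t.
- have rc : reach c true.
    by apply: connect_trans rx (connect1 _); rewrite /dstep /= xc andbF.
  have [canc|canc] := boolP (c \in anc_set Z).
    right; exists false; apply: connect_trans rc (connect1 _).
    by rewrite /dstep /= yc canc.
  have cZ : c \notin Z by apply: contra canc; apply: mem_anc_set.
  case/anc_setP: cA => t; rewrite !inE => /or3P[/eqP->|/eqP->|tZ] ct.
  + right; exists false; apply: connect_trans (reach_back canc ct) (connect1 _).
    by rewrite /dstep /= yc cZ.
  + by left; apply: reach_forward rc.
  + by case/negP: canc; apply/anc_setP; exists t.
Qed.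

Lemma dconnected_moral : dconnected G Z a b <-> connect (moral_off A Z) a b.
Proof.
rewrite dconnected_dstep //; split=> [[e /connectP[p pth lst]]|]; last exact: moral_reach.
exact: dstep_moral pth (esym lst).
Qed.

Lemma ndepE : ndep G Z a b = connect (moral_off A Z) a b.
Proof. by apply/asboolP/idP => /dconnected_moral. Qed.

End Endpoints.
End MoralGraph.

(** * Uncovered paths and p-adjacency *)

Section Uncovered.
Variables (T : eqType) (adj le : rel T).
Implicit Types (x : nat -> T) (i j k : nat).

(** An induced path at positions [j] to [k]. Windows of an infinite sequence make passing to a
    subpath a change of bounds. *)
Definition uncovered x j k : Prop :=
  forall i i', j <= i -> i < i' -> i' <= k ->
    x i != x i' /\ adj (x i) (x i') = (i' == i.+1).

Definition summit x j k : Prop :=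
  [/\ j.+1 < k, (forall i, j < i < k -> le (x i) (x j.+1) && le (x j.+1) (x i)),
      ~~ le (x j.+1) (x j) & ~~ le (x j.+1) (x k)].

(* The paths counted by [Dset], as stretches of an infinite sequence, for a
   preorder on vertices in place of the order on blocks. *)
Definition plateau x j k : Prop := uncovered x j k /\ summit x j k.

Lemma uncoveredS x j k j' k' : j <= j' -> k' <= k -> uncovered x j k -> uncovered x j' k'.
Proof. by move=> jj' kk' unc i i' ji ii' ik; apply: unc; lia. Qed.

Lemma uncovered_shift x j k d :
  uncovered x (j + d) (k + d) <-> uncovered (fun i => x (i + d)) j k.
Proof.
split=> unc i i' ji ii' ik.
  by have [-> ->] := unc (i + d) (i' + d) ltac:(lia) ltac:(lia) ltac:(lia); split=> //; lia.
have := unc (i - d) (i' - d) ltac:(lia) ltac:(lia) ltac:(lia).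
by rewrite !subnK ?(leq_trans _ (ltnW ii')) //; try lia; case=> -> ->; split=> //; lia.
Qed.

Lemma summit_shift x j k d :
  summit x (j + d) (k + d) <-> summit (fun i => x (i + d)) j k.
Proof.
split=> -[jk mid e1 e2]; split=> //; try lia.
  by move=> i ijk; apply: (mid (i + d)); lia.
move=> i ijk; have /= := mid (i - d); rewrite subnK; last lia.
by apply; lia.
Qed.

Lemma plateau_shift x j k d :
  plateau x (j + d) (k + d) <-> plateau (fun i => x (i + d)) j k.
Proof. by split=> -[/uncovered_shift ? /summit_shift]. Qed.

Lemma uncovered_ext x y j k :
  (forall i, j <= i <= k -> x i = y i) -> uncovered x j k -> uncovered y j k.
Proof. by move=> xy unc i i' ? ? ?; rewrite -!xy; [exact: unc | lia | lia]. Qed.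

Lemma plateau_ext x y j k :
  (forall i, j <= i <= k -> x i = y i) -> plateau x j k -> plateau y j k.
Proof.
move=> xy [unc [jk mid e1 e2]]; split; first exact: uncovered_ext unc.
split=> //; try by rewrite -!xy //; lia.
by move=> i ijk; rewrite -!xy; [exact: mid | lia | lia].
Qed.

Lemma uncovered_rev x m : symmetric adj ->
  uncovered x 0 m -> uncovered (fun i => x (m - i)) 0 m.
Proof.
move=> adjC unc i i' _ ii' im.
have [ne e] := unc (m - i') (m - i) ltac:(lia) ltac:(lia) ltac:(lia).
by rewrite eq_sym adjC; split=> //; rewrite e; lia.
Qed.

(* The shortest stretch with an interior element below neither endpoint is a summit. *)
Lemma summit_exists x j k c :
    reflexive le -> transitive le -> j < c < k ->
    ~~ le (x c) (x j) -> ~~ le (x c) (x k) ->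
  exists j' k', [/\ j <= j', k' <= k, summit x j' k' &
                    forall i, j' < i < k' -> le (x c) (x i)].
Proof.
move=> lexx le_trans; have [m] := ubnP (k - j); elim: m => // m IH in j k c *.
rewrite ltnS => km cjk cj ck.
have [[i ijk ci]|all_above] := pselect (exists2 i, j < i < k & ~~ le (x c) (x i)).
  have [ic|ic] := ltnP i c.
    have [j' [k' [? ? ? ?]]] := IH i k c ltac:(lia) ltac:(lia) ci ck.
    by exists j', k'; split=> //; lia.
  have ic' : c < i by rewrite ltn_neqAle ic andbT; apply: contraNneq ci => ->.
  have [j' [k' [? ? ? ?]]] := IH j i c ltac:(lia) ltac:(lia) cj ci.
  by exists j', k'; split=> //; lia.
have above i : j < i < k -> le (x c) (x i).
  by move=> ijk; apply: contraT => ci; case: all_above; exists i.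
(* All interior elements are now above [x c]. If one is not below another, it takes the role of [c]
   on a stretch that ends at the other. *)
have [[i ijk [i' ijk' ii']]|equiv] := pselect (exists2 i, j < i < k &
    exists2 i', j < i' < k & ~~ le (x i) (x i')).
  have ij : ~~ le (x i) (x j) by apply: contra cj; apply: le_trans (above i ijk).
  have ik : ~~ le (x i) (x k) by apply: contra ck; apply: le_trans (above i ijk).
  have [j' [k' [? ? P Q]]] : exists j' k', [/\ j <= j', k' <= k, summit x j' k' &
                    forall i0, j' < i0 < k' -> le (x i) (x i0)].
    have [lt|lt] := ltnP i' i.
      have [j' [k' [? ? ? ?]]] := IH i' k i ltac:(lia) ltac:(lia) ii' ik.
      by exists j', k'; split=> //; lia.
    have lt' : i < i' by rewrite ltn_neqAle lt andbT; apply: contraNneq ii' => ->.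
    have [j' [k' [? ? ? ?]]] := IH j i' i ltac:(lia) ltac:(lia) ij ii'.
    by exists j', k'; split=> //; lia.
  exists j', k'; split=> // i0 /Q; apply: le_trans; exact: above.
have {}equiv i i' : j < i < k -> j < i' < k -> le (x i) (x i').
  by move=> ? ?; apply: contraT => ?; case: equiv; exists i => //; exists i'.
exists j, k; split=> //; split=> //; first lia.
- by move=> i ijk; rewrite !equiv //; lia.
- by apply: contra cj; apply: le_trans (above _ _); lia.
- by apply: contra ck; apply: le_trans (above _ _); lia.
Qed.

End Uncovered.

Section PAdjacency.
Variable n : nat.
Local Notation T := 'I_n.
Variable G : rel T.
Implicit Types (Z A : {set T}) (a b c u v x y : T).

(** Adjacency in the moral graph of the ancestors of the pair alone. No set then separates the two
    vertices ([padj_ndep]), and otherwise their remaining ancestors do ([ndep_rest]). *)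
Definition padj : rel T :=
  fun u v => (u != v) && moral G (anc_set G [set u; v]) u v.

Lemma padjC : symmetric padj.
Proof. by move=> u v; rewrite /padj eq_sym setUC moral_sym. Qed.

Lemma edge_padj u v : G u v -> u != v -> padj u v.
Proof. by move=> uv ne; rewrite /padj ne /moral uv. Qed.

Lemma padj_moral A u v : (forall x y, connect G x y -> y \in A -> x \in A) ->
  u \in A -> v \in A -> padj u v -> moral G A u v.
Proof.
move=> clA uA vA /andP[_]; apply: moralS; rewrite -(anc_set_id clA).
by apply: anc_setS; apply/subsetP=> x; rewrite !inE => /orP[] /eqP->.
Qed.

Lemma padj_moral_off S Z u v : u \in anc_set G S :\: Z -> v \in anc_set G S :\: Z ->
  padj u v -> moral_off G (anc_set G S) Z u v.
Proof.
move=> /[dup] /setDP[uA _] uAZ /[dup] /setDP[vA _] vAZ uv; apply/and3P; split=> //.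
by apply: padj_moral uv => //; apply: anc_set_closed.
Qed.

Lemma padj_ndep Z a b : a \notin Z -> b \notin Z -> padj a b -> ndep G Z a b.
Proof.
move=> aZ bZ ab; rewrite ndepE //; apply: connect1; apply: padj_moral_off => //.
  by rewrite inE aZ mem_anc_set // !inE eqxx.
by rewrite inE bZ mem_anc_set // !inE eqxx orbT.
Qed.

Lemma ndep_chain Z a b c : a \notin Z -> b \notin Z -> c \notin Z ->
  padj a b -> padj c b -> b \in anc_set G (a |: (c |: Z)) -> ndep G Z a c.
Proof.
move=> aZ bZ cZ ab cb bA; rewrite ndepE //.
have bA' : b \in anc_set G (a |: (c |: Z)) :\: Z by rewrite in_setD bZ.
apply: (@connect_trans _ _ b); apply: connect1; apply: padj_moral_off => //.
- by rewrite in_setD aZ mem_anc_set // !inE eqxx.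
- by rewrite in_setD cZ mem_anc_set // !inE eqxx orbT.
- by rewrite padjC.
Qed.

(** With the rest of [A] conditioned on, only [a] and [b] remain in the moral graph, so a connection
    is a single edge. *)
Lemma ndep_rest A a b : (forall x y, connect G x y -> y \in A -> x \in A) ->
  a \in A -> b \in A -> a != b -> ndep G (A :\: [set a; b]) a b = moral G A a b.
Proof.
move=> clA aA bA ab; rewrite ndepE; try by rewrite !inE eqxx ?orbT.
have -> : a |: (b |: A :\: [set a; b]) = A.
  apply/setP=> x; rewrite !inE.
  by case: (eqVneq x a) => [->|] //=; case: (eqVneq x b) => [->|].
rewrite anc_set_id //; set Z := _ :\: _.
have off x : x \in A :\: Z -> x = a \/ x = b.
  rewrite !inE; case: (eqVneq x a); first by left.
  by case: (eqVneq x b); [right | move=> _ _ /=; case: (x \in A)].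
have aZ : a \in A :\: Z by rewrite !inE eqxx aA.
have bZ : b \in A :\: Z by rewrite !inE eqxx orbT bA.
apply/idP/idP=> [/connectP[p pth lst]|mab]; last by apply: connect1; apply/and3P.
elim: p pth lst => [_ /= ba|x p IH /= /andP[/and3P[_ xAZ ax] pth] lst].
  by rewrite ba eqxx in ab.
by have [xa|xb] := off _ xAZ; [subst x; apply: IH | subst x].
Qed.

Definition vtriple a b c := [&& distinct3 a b c, padj a b, padj c b & ~~ padj a c].

(** For an unshielded triple this is membership in [E3] of the strong components, by [scc_E3]:
    conditioning on [b] marries [a] and [c]. *)
Definition joint_child_above a b c := [exists d, [&& G a d, G c d & connect G d b]].

End PAdjacency.

(** * The score sets in terms of an order on vertices *)

Section BlockOrder.
Variable n : nat.
Local Notation T := 'I_n.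
Variable P : {set {set T}}.
Variable pi : {set ({set T} * {set T})}.
Hypothesis pop : is_popartition P pi.
Implicit Types (a b c x y : T).

(** A preorder on vertices whose classes are the blocks, so that partitions and ancestry can be
    compared directly. *)
Definition ble x y := ple pi (blk P x) (blk P y).

Lemma pop_partition : partition P [set: T]. Proof. by case/and5P: pop. Qed.

Lemma mem_blk x : x \in blk P x.
Proof. by rewrite mem_pblock (cover_partition pop_partition). Qed.

Lemma blk_mem x : blk P x \in P.
Proof. by rewrite pblock_mem // (cover_partition pop_partition). Qed.

Lemma ble_refl x : ble x x.
Proof. by case/and5P: pop => _ _ /forall_inP H _ _; apply/H/blk_mem. Qed.

Lemma ble_trans : transitive ble.
Proof.
move=> y x z xy yz; case/and5P: pop => _ _ _ _ /forallP/(_ (blk P x)).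
by move/forallP/(_ (blk P y))/forallP/(_ (blk P z))/implyP; apply; apply/andP.
Qed.

Lemma ble_anti x y : ble x y && ble y x = (blk P x == blk P y).
Proof.
apply/idP/eqP=> [xy|e]; last by rewrite /ble e -/(ble y y) ble_refl.
case/and5P: pop => _ _ _ /forallP/(_ (blk P x))/forallP/(_ (blk P y))/implyP H _.
exact/eqP/H.
Qed.

Lemma mem_below Cs R x : (x \in below P pi Cs R) = (x \notin R) && plemax pi (blk P x) Cs.
Proof.
rewrite inE; congr (_ && _); apply/bigcupP/idP=> [[C /andP[CP le] xC]|le].
  by rewrite /blk (def_pblock _ CP xC) //; case/and3P: pop_partition.
by exists (blk P x); rewrite ?mem_blk // blk_mem.
Qed.

Lemma plemax2 x y z : plemax pi (blk P x) [:: blk P y; blk P z] = ble x y || ble x z.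
Proof. by rewrite /plemax /= orbF. Qed.

Lemma plemax3 x y z t :
  plemax pi (blk P x) [:: blk P y; blk P z; blk P t] = [|| ble x y, ble x z | ble x t].
Proof. by rewrite /plemax /= orbF. Qed.

Variable G : rel T.

Lemma mem_E1 a b : (a, b) \in E1 G P pi =
  (a != b) && ndep G (below P pi [:: blk P a; blk P b] [set a; b]) a b.
Proof. by rewrite inE. Qed.

(** No set separates a p-adjacent pair, so these pairs occur in [E1] for every partition; the strong
    components have no others. *)
Lemma padj_E1 a b : padj G a b -> (a, b) \in E1 G P pi.
Proof.
move=> ab; rewrite mem_E1 (andP ab).1 padj_ndep // mem_below !inE eqxx ?orbT //.
Qed.

Hypothesis E1E : forall a b, (a, b) \in E1 G P pi = padj G a b.

Lemma vbaseE a b c : vbase G P pi (a, b, c) = vtriple G a b c.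
Proof. by rewrite /vbase /vtriple !E1E. Qed.

Lemma mem_E2 a b c : (a, b, c) \in E2 G P pi = vtriple G a b c && (ble b a || ble b c).
Proof. by rewrite inE vbaseE plemax2. Qed.

Lemma mem_E3 a b c : (a, b, c) \in E3 G P pi =
  vtriple G a b c && ndep G (below P pi [:: blk P a; blk P b; blk P c] [set a; c]) a c.
Proof. by rewrite inE vbaseE. Qed.

Lemma mem_E4 a b1 c b2 : ((a, b1, c), (a, b2, c)) \in E4 G P pi =
  [&& vtriple G a b1 c, vtriple G a b2 c, (a, b1, c) \notin E2 G P pi :|: E3 G P pi,
      (a, b2, c) \notin E2 G P pi :|: E3 G P pi & ble b1 b2].
Proof. by rewrite inE !eqxx !vbaseE. Qed.

Lemma mem_E4_shape z : z \in E4 G P pi ->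
  exists a b1 b2 c, z = ((a, b1, c), (a, b2, c)).
Proof.
case: z => [[[a b1] c] [[a' b2] c']]; rewrite inE => /and3P[/eqP-> /eqP-> _].
by exists a, b1, b2, c.
Qed.

Lemma mem_Dset t (s : t.+2.-tuple T) : 0 < t ->
  reflect (plateau (padj G) ble (nth (thead s) s) 0 t.+1) (s \in Dset G P pi t).
Proof.
move=> t0; rewrite inE /Dpred; set x := nth _ _.
have szs : size s = t.+2 by rewrite size_tuple.
apply: (iffP and5P) => [[unq cons far blks top]|[unc [_ mid e1 e2]]]; last split.
- have unc : uncovered (padj G) x 0 t.+1.
    move=> i j _ ij jt; have jt' : j < t.+2 by [].
    split; first by rewrite nth_uniq // ?szs; lia.
    have [->|ne] := eqVneq j i.+1.
      by have /forallP/(_ (Ordinal (leq_trans ij jt))) := cons; rewrite E1E.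
    have /forallP/(_ (Ordinal jt'))/forallP/(_ (Ordinal (ltn_trans ij jt')))/implyP := far.
    by move=> /= /(_ ltac:(lia)); rewrite E1E padjC => /negbTE.
  have top' := top; rewrite plemax2 negb_or in top'; case/andP: top' => e1 e2; split=> //; split=> //.
  move=> i /andP[i0 it]; rewrite ble_anti.
  by have /forallP/(_ (Ordinal it))/implyP := blks; apply.
- apply: contraT => /(uniqPn (thead s)) [i [j [ij jt]]].
  by rewrite szs in jt; have [/eqP ? _] := unc i j isT ij jt.
- apply/forallP=> -[i it] /=; rewrite E1E.
  by have [_ ->] := unc i i.+1 isT (ltnSn i) it.
- apply/forallP=> -[i it]; apply/forallP=> -[j jt] /=; apply/implyP=> ij.
  rewrite E1E padjC; have [_ ->] := unc j i isT ltac:(lia) it; lia.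
- apply/forallP=> -[i it] /=; apply/implyP=> i0.
  by rewrite -ble_anti; apply: mid; rewrite i0.
- by rewrite plemax2 negb_or e1 e2.
Qed.

Lemma Dset_mkseq t (x : nat -> T) j : 0 < t ->
  reflect (plateau (padj G) ble x j (t.+1 + j))
    ([tuple of mkseq (fun i => x (i + j)) t.+2] \in Dset G P pi t).
Proof.
move=> t0; apply: (equivP (mem_Dset _ t0)); set y := nth _ _.
have sh := plateau_shift (padj G) ble x 0 t.+1 j; rewrite add0n in sh.
apply: iff_trans (iff_sym sh).
have xy i : 0 <= i <= t.+1 -> y i = x (i + j) by move=> it; rewrite /y /= nth_mkseq.
by split; apply: plateau_ext => i /xy.
Qed.

(** Non-adjacency of [a] and [c], part of [vtriple], comes from the uncovered path: for [t > 0] its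
    ends are not consecutive. *)
Lemma mem_E6t t (s : t.+2.-tuple T) a b c : 0 < t ->
  ((s, (a, b, c)) \in E6t G P pi t) =
  [&& s \in Dset G P pi t, a == nth (thead s) s 0, c == nth (thead s) s t.+1, vtriple G a b c,
      (a, b, c) \notin E2 G P pi :|: E3 G P pi & ble (nth (thead s) s 1) b].
Proof.
move=> t0; rewrite [LHS]inE; set E23 := _ \notin _ :|: _.
have xE i : i <= t.+1 -> nth a s i = nth (thead s) s i.
  by move=> it; apply: set_nth_default; rewrite size_tuple.
rewrite /= !xE //; case: (eqVneq a) => [ea|] /=; last by rewrite !andbF.
case: (eqVneq c) => [ec|] /=; last by rewrite !andbF.
rewrite /vtriple !E1E /ble.
have -> : (Dpred G P pi s) = (s \in Dset G P pi t) by rewrite inE.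
case: (mem_Dset s t0) => [[unc _]|]; last by rewrite !andbF.
have [_] := unc 0 t.+1 isT isT (leqnn _); rewrite -ea -ec => ->.
by rewrite !andbA !andbT /=; lia.
Qed.

End BlockOrder.

(** * The partition into strong components *)

Section StrongComponents.
Variable n : nat.
Local Notation T := 'I_n.
Variable G : rel T.
Implicit Types (a b c d x y : T).

Definition scc : {set {set T}} :=
  equivalence_partition (fun x y => connect G x y && connect G y x) [set: T].

Definition scc_le : {set ({set T} * {set T})} :=
  [set CC in setX scc scc | [exists x in CC.1, [exists y in CC.2, connect G x y]]].

Let scc_equiv : {in [set: T] & &,
  equivalence_rel (fun x y => connect G x y && connect G y x)}.
Proof.
move=> x y z _ _ _; split=> [|/andP[xy yx]]; first by rewrite connect0.
congr (_ && _); apply/idP/idP; first [exact: connect_trans | move=> h; exact: connect_trans h _].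
Qed.

Lemma scc_partition : partition scc [set: T].
Proof. exact: equivalence_partitionP scc_equiv. Qed.

Lemma mem_scc x y : (y \in blk scc x) = connect G x y && connect G y x.
Proof. exact: (pblock_equivalence_partition scc_equiv (in_setT x) (in_setT y)). Qed.

Lemma scc_blk_mem x : blk scc x \in scc.
Proof. by rewrite pblock_mem // (cover_partition scc_partition). Qed.

Lemma scc_blk C : C \in scc -> exists x, C = blk scc x.
Proof.
move=> CP; case/and3P: scc_partition => _ tI n0.
have /set0Pn[x xC] : C != set0 by apply: contraNneq n0 => <-.
by exists x; rewrite /blk (def_pblock tI CP xC).
Qed.

(** It turns the conditioning sets of the score into ancestral sets with two vertices removed, as
    [ndep_rest] wants. *)
Lemma ble_scc x y : ble scc scc_le x y = connect G x y.
Proof.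
rewrite /ble /ple !inE /= !scc_blk_mem /=.
apply/exists_inP/idP=> [[x' xx' /exists_inP[y' yy' xy]]|xy].
  move: xx' yy'; rewrite !mem_scc => /andP[xx' _] /andP[_ y'y].
  exact: connect_trans xx' (connect_trans xy y'y).
by exists x; rewrite ?mem_scc ?connect0 //; apply/exists_inP; exists y; rewrite ?mem_scc ?connect0.
Qed.

Lemma scc_popartition : is_popartition scc scc_le.
Proof.
have inP C1 C2 : (C1, C2) \in scc_le -> C1 \in scc /\ C2 \in scc.
  by rewrite !inE => /andP[/andP[]].
apply/and5P; split; first exact: scc_partition.
- by apply/subsetP=> CC; rewrite inE => /andP[].
- apply/forall_inP=> C /scc_blk[x ->].
  by rewrite -[_ \in _]/(ble scc scc_le x x) ble_scc connect0.
- apply/forallP=> C1; apply/forallP=> C2; apply/implyP=> /andP[le12 le21].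
  have [/scc_blk[x e1] /scc_blk[y e2]] := inP _ _ le12; subst C1 C2.
  move: le12 le21; rewrite -[_ \in _]/(ble scc scc_le x y) -[_ \in scc_le]/(ble scc scc_le y x) !ble_scc.
  move=> xy yx; apply/eqP/setP=> z; rewrite !mem_scc; apply/andP/andP=> -[z1 z2].
    by split; [exact: connect_trans z1 | exact: connect_trans xy].
  by split; [exact: connect_trans z1 | exact: connect_trans yx].
- apply/forallP=> C1; apply/forallP=> C2; apply/forallP=> C3; apply/implyP=> /andP[le12 le23].
  have [/scc_blk[x e1] /scc_blk[y e2]] := inP _ _ le12.
  have [_ /scc_blk[z e3]] := inP _ _ le23; subst C1 C2 C3.
  move: le12 le23; rewrite -[_ \in _]/(ble scc scc_le x y) -[_ \in scc_le]/(ble scc scc_le y z).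
  rewrite -[(_, _) \in scc_le]/(ble scc scc_le x z) !ble_scc; exact: connect_trans.
Qed.

Lemma scc_below2 a b :
  below scc scc_le [:: blk scc a; blk scc b] [set a; b] = anc_set G [set a; b] :\: [set a; b].
Proof.
apply/setP=> x; rewrite (mem_below scc_popartition) plemax2 !ble_scc in_setD.
congr (_ && _); apply/orP/anc_setP=> [[]|[y]]; first by exists a; rewrite // !inE eqxx.
  by exists b; rewrite // !inE eqxx orbT.
by rewrite !inE => /orP[] /eqP-> ->; [left|right].
Qed.

Lemma scc_below3 a b c :
  below scc scc_le [:: blk scc a; blk scc b; blk scc c] [set a; c] =
  anc_set G [set a; b; c] :\: [set a; c].
Proof.
apply/setP=> x; rewrite (mem_below scc_popartition) plemax3 !ble_scc in_setD.
congr (_ && _); apply/or3P/anc_setP=> [[]|[y]]; first by exists a; rewrite // !inE eqxx.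
- by exists b; rewrite // !inE eqxx ?orbT.
- by exists c; rewrite // !inE eqxx ?orbT.
rewrite !inE => /orP[/orP[]|] /eqP-> ->; by [exact: Or31|exact: Or32|exact: Or33].
Qed.

Lemma scc_E1 a b : (a, b) \in E1 G scc scc_le = padj G a b.
Proof.
rewrite (mem_E1 scc scc_le) scc_below2 /padj; case: (eqVneq a b) => //= ab.
rewrite ndep_rest //; first by move=> x y; apply: anc_set_closed.
all: by rewrite mem_anc_set // !inE eqxx ?orbT.
Qed.

(** Only a moral edge between [a] and [c] can connect them. Not being p-adjacent, they have no edge
    and no common child ancestral to either, so the child that marries them is an ancestor of
    [b]. *)
Lemma scc_E3 a b c :
  (a, b, c) \in E3 G scc scc_le = vtriple G a b c && joint_child_above G a b c.
Proof.
rewrite (mem_E3 scc_E1); case V: (vtriple G a b c) => //=.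
case/and4P: V => /and3P[_ _ ac] _ _ nac; rewrite scc_below3 ndep_rest //.
- apply/idP/existsP=> [/or3P[E|E|/exists_inP[d dA /andP[ad cd]]]|[d /and3P[ad cd db]]].
  + by rewrite edge_padj in nac.
  + by rewrite padjC edge_padj // eq_sym in nac.
  + exists d; rewrite ad cd /=; case/anc_setP: dA => y; rewrite !inE -orbA.
    case/or3P=> /eqP-> // dy; case/negP: nac; rewrite /padj ac; apply/or3P; apply: Or33;
      apply/exists_inP; exists d; rewrite ?ad ?cd //; apply/anc_setP.
      by exists a; rewrite ?inE ?eqxx.
    by exists c; rewrite ?inE ?eqxx ?orbT.
  + apply/or3P; apply: Or33; apply/exists_inP; exists d; rewrite ?ad //.
    by apply/anc_setP; exists b; rewrite // !inE eqxx orbT.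
- by move=> x y; apply: anc_set_closed.
- by rewrite mem_anc_set // !inE eqxx.
- by rewrite mem_anc_set // !inE eqxx orbT.
Qed.

End StrongComponents.

Lemma ndep_path n (G : rel 'I_n) (Z : {set 'I_n}) (x : nat -> 'I_n) m :
  x 0 \notin Z -> x m \notin Z ->
  (forall i, 0 < i < m -> x i \in anc_set G (x 0 |: (x m |: Z)) :\: Z) ->
  (forall i, i < m -> padj G (x i) (x i.+1)) -> ndep G Z (x 0) (x m).
Proof.
move=> x0 xm xi adj; rewrite ndepE //; set A := anc_set _ _ in xi *.
have xA i : i <= m -> x i \in A :\: Z.
  rewrite in_setD; case: (posnP i) => [->|i0].
    by rewrite x0 mem_anc_set // !inE eqxx.
  rewrite leq_eqVlt => /orP[/eqP->|im]; first by rewrite xm mem_anc_set // !inE eqxx orbT.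
  by rewrite -in_setD xi // i0.
suff: forall i, i <= m -> connect (moral_off G A Z) (x 0) (x i) by apply.
elim=> [|i IH] im; first exact: connect0.
apply: connect_trans (IH (ltnW im)) (connect1 _).
by apply: padj_moral_off; rewrite ?xA ?adj // ltnW.
Qed.

Lemma plateau_eq_le (T : eqType) (adj le le' : rel T) x j k :
  le =2 le' -> plateau adj le x j k -> plateau adj le' x j k.
Proof. by move=> E [? [? mid ? ?]]; split=> //; split=> //; rewrite -?E // => i /mid; rewrite -!E. Qed.

Lemma scc_Dset n (G : rel 'I_n) t (s : t.+2.-tuple 'I_n) : 0 < t ->
  reflect (plateau (padj G) (connect G) (nth (thead s) s) 0 t.+1)
    (s \in Dset G (scc G) (scc_le G) t).
Proof.
move=> t0; apply: (equivP (mem_Dset (scc_popartition G) (@scc_E1 _ G) s t0)).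
by split; apply: plateau_eq_le => a b; rewrite ble_scc.
Qed.

Lemma scc_Dset_mkseq n (G : rel 'I_n) t (x : nat -> 'I_n) j : 0 < t ->
  reflect (plateau (padj G) (connect G) x j (t.+1 + j))
    ([tuple of mkseq (fun i => x (i + j)) t.+2] \in Dset G (scc G) (scc_le G) t).
Proof.
move=> t0; apply: (equivP (Dset_mkseq (scc_popartition G) (@scc_E1 _ G) x j t0)).
by split; apply: plateau_eq_le => a b; rewrite ble_scc.
Qed.

(** * Comparison of a competitor with the strong components *)

Section MinimizerScore.
Variable n : nat.
Local Notation T := 'I_n.
Variable G : rel T.
Variable P : {set {set T}}.
Variable pi : {set ({set T} * {set T})}.
Hypothesis pop : is_popartition P pi.
Implicit Types (a b c d x y : T).
Local Notation Ps := (scc G).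
Local Notation pis := (scc_le G).
Local Notation ble := (ble P pi).

Lemma subset_E1 : E1 G Ps pis \subset E1 G P pi.
Proof. by apply/subsetP=> -[a b]; rewrite scc_E1; apply: padj_E1. Qed.

Hypothesis E1E : forall a b, (a, b) \in E1 G P pi = padj G a b.

Lemma nadj_ndep a c : a != c -> ~~ padj G a c ->
  ~~ ndep G (below P pi [:: blk P a; blk P c] [set a; c]) a c.
Proof. by move=> ac; rewrite -E1E mem_E1 ac. Qed.

(** Otherwise [b] lies outside the set separating [a] and [c], yet is an ancestor of one of them,
    and the chain through [b] connects them. *)
Lemma subset_E2 : E2 G Ps pis \subset E2 G P pi.
Proof.
apply/subsetP=> -[[a b] c]; rewrite (mem_E2 (@scc_E1 _ G)) (mem_E2 E1E) !ble_scc.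
case/andP=> V bac; rewrite V /= -(plemax2 P pi).
case/and4P: V => /and3P[ab bc ac] Eab Ecb nac; apply: contraT => nb.
case/negP: (nadj_ndep ac nac); apply: ndep_chain Eab Ecb _.
- by rewrite (mem_below pop) !inE eqxx.
- by rewrite (mem_below pop) (negbTE nb) andbF.
- by rewrite (mem_below pop) !inE eqxx orbT.
- by case/orP: bac => h; apply/anc_setP; [exists a|exists c]; rewrite // !inE eqxx ?orbT.
Qed.

(** The conditioning set contains [b], so the common child ancestral to [b] marries [a] and [c]. *)
Lemma subset_E3 : E3 G Ps pis \subset E3 G P pi.
Proof.
apply/subsetP=> -[[a b] c]; rewrite scc_E3 (mem_E3 E1E) => /andP[V /existsP[d /and3P[ad cd db]]].
rewrite V; case/and4P: V => /and3P[ab bc ac] _ _ _; set Z := below _ _ _ _.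
have aZ : a \notin Z by rewrite (mem_below pop) !inE eqxx.
have cZ : c \notin Z by rewrite (mem_below pop) !inE eqxx orbT.
have bZ : b \in Z.
  by rewrite (mem_below pop) !inE plemax3 (ble_refl pop) orbT (negbTE bc) eq_sym (negbTE ab).
rewrite ndepE //; apply: connect1; apply/and3P; split.
- by rewrite in_setD aZ mem_anc_set // !inE eqxx.
- by rewrite in_setD cZ mem_anc_set // !inE eqxx orbT.
- apply/or3P; apply: Or33; apply/exists_inP; exists d; rewrite ?ad //.
  by apply/anc_setP; exists b; rewrite // !in_setU1 bZ !orbT.
Qed.

Hypothesis E2E : E2 G P pi = E2 G Ps pis.
Hypothesis E3E : E3 G P pi = E3 G Ps pis.

Lemma nE3_ndep a b c : vtriple G a b c -> (a, b, c) \notin E3 G P pi ->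
  ~~ ndep G (below P pi [:: blk P a; blk P b; blk P c] [set a; c]) a c.
Proof. by move=> V; rewrite (mem_E3 E1E) V. Qed.

(** If [b1] is not below [b2], then, being below neither [a] nor [c] outside [E2], it avoids the
    conditioning set of [(a, b2, c)]. As an ancestor of [b2], which is in that set, it connects [a]
    and [c], putting this triple in [E3]. *)
Lemma subset_E4 : E4 G Ps pis \subset E4 G P pi.
Proof.
apply/subsetP=> z /[dup] /mem_E4_shape[a [b1 [b2 [c ->]]]].
rewrite (mem_E4 (@scc_E1 _ G)) (mem_E4 E1E) E2E E3E => /and5P[V1 V2 n1 n2]; rewrite ble_scc => b12.
rewrite V1 V2 n1 n2 /=; move: n1 n2; rewrite !in_setU !negb_or -E2E -E3E => /andP[n12 _] /andP[_ n23].
have := nE3_ndep V2 n23; apply: contraR => nle.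
have nb1 : ~~ [|| ble b1 a, ble b1 b2 | ble b1 c].
  by move: n12; rewrite (mem_E2 E1E) V1 (negbTE nle).
case/and4P: V1 => _ Eab Ecb _; case/and4P: V2 => /and3P[ab2 b2c _] _ _ _.
apply: ndep_chain Eab Ecb _; rewrite ?(mem_below pop) ?in_set2 ?eqxx ?orbT //.
  by rewrite plemax3 (negbTE nb1) andbF.
apply/anc_setP; exists b2 => //; rewrite !in_setU1 (mem_below pop) in_set2 plemax3 (ble_refl pop) orbT.
by rewrite (negbTE b2c) eq_sym (negbTE ab2) !orbT.
Qed.

Lemma uncovered_vtriple (x : nat -> T) j :
  uncovered (padj G) x j j.+2 -> vtriple G (x j) (x j.+1) (x j.+2).
Proof.
move=> unc; have [n1 a1] := unc j j.+1 ltac:(lia) ltac:(lia) ltac:(lia).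
have [n2 a2] := unc j.+1 j.+2 ltac:(lia) ltac:(lia) ltac:(lia).
have [n3 a3] := unc j j.+2 ltac:(lia) ltac:(lia) ltac:(lia).
by rewrite /vtriple /distinct3 n1 n2 n3 a1 [padj _ (x j.+2) _]padjC a2 a3; lia.
Qed.

Lemma ble_connect_vtriple a b c : vtriple G a b c ->
  ble b a || ble b c = connect G b a || connect G b c.
Proof.
move=> V; have /setP/(_ (a, b, c)) := E2E.
by rewrite (mem_E2 (@scc_E1 _ G)) (mem_E2 E1E) V !ble_scc.
Qed.

(** The score has no entry for [t = 1], but this set is the complement of [E2] among the unshielded
    triples. *)
Lemma Dset1_scc : Dset G P pi 1 = Dset G Ps pis 1.
Proof.
have key (x : nat -> T) (le le' : rel T) : reflexive le' ->
    (uncovered (padj G) x 0 2 ->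
       le (x 1) (x 0) || le (x 1) (x 2) = le' (x 1) (x 0) || le' (x 1) (x 2)) ->
    plateau (padj G) le x 0 2 -> plateau (padj G) le' x 0 2.
  move=> le'xx E [unc [_ _ e1 e2]]; have := E unc; rewrite (negbTE e1) (negbTE e2).
  move/esym/negbT; rewrite negb_or => /andP[? ?]; split=> //; split=> // i ijk.
  by have -> : i = 1 by [lia]; rewrite le'xx.
apply/setP=> s; apply/(mem_Dset pop E1E)/scc_Dset => //; apply: key.
- exact: connect0.
- by move=> /uncovered_vtriple/ble_connect_vtriple.
- exact: ble_refl.
- by move=> /uncovered_vtriple/ble_connect_vtriple.
Qed.

(** The reversed inclusion matches the minus sign in the score. Either the path is a summit for
    ancestry too, or its interior consists of ancestors of the ends outside their separating set and
    would connect them. *)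
Lemma subset_Dset t : 1 < t ->
  (forall s, 1 < s < t -> Dset G P pi s = Dset G Ps pis s) ->
  Dset G P pi t \subset Dset G Ps pis t.
Proof.
move=> t1 IH; apply/subsetP=> s /(mem_Dset pop E1E s (ltnW t1)) pl; apply/scc_Dset; first exact: ltnW.
move: (nth _ _) pl => x [unc [_ mid e1 e2]].
have int i : 0 < i < t.+1 -> ~~ ble (x i) (x 0) && ~~ ble (x i) (x t.+1).
  move=> /mid /andP[_ le1]; apply/andP; split; [apply: contra e1|apply: contra e2];
  exact: (ble_trans pop le1).
have [ne adj] := unc 0 t.+1 isT isT (leqnn _).
have [[c ct /andP[c0 c1]]|low] := pselect (exists2 c, 0 < c < t.+1 &
    ~~ connect G (x c) (x 0) && ~~ connect G (x c) (x t.+1)).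
  have [j [k [_ kt [jk mid' f1 f2] _]]] := summit_exists (fun i => connect0 _ _)
    (@connect_trans _ G) ct c0 c1.
  have unc' : uncovered (padj G) x j k by apply: uncoveredS unc.
  have [[j0 k1]|notall] := pselect (j = 0 /\ k = t.+1); first by subst j k.
  (* A proper stretch has an end interior to the plateau, hence equivalent to its own interior. By
     agreement on shorter paths, or on [E2] for one interior vertex, it is no summit for
     ancestry. *)
  have ends : ble (x j.+1) (x j) || ble (x j.+1) (x k).
    have eq i i' : 0 < i < t.+1 -> 0 < i' < t.+1 -> ble (x i) (x i').
      by move=> /mid/andP[h _] /mid/andP[_ h']; apply: (ble_trans pop h).
    have [j0|j0] := posnP j; apply/orP; [right|left]; apply: eq; lia.
  exfalso; have [k2|k2] := eqVneq k j.+2.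
    subst k; have := ble_connect_vtriple (uncovered_vtriple unc').
    by rewrite ends (negbTE f1) (negbTE f2).
  have st : 1 < k - j.+1 < t by lia.
  have kE : (k - j.+1).+1 + j = k by lia.
  have /(scc_Dset_mkseq G x j (ltnW (andP st).1)) : plateau (padj G) (connect G) x j ((k - j.+1).+1 + j).
    by rewrite kE.
  rewrite -IH // => /(Dset_mkseq pop E1E _ _ (ltnW (andP st).1)) [_ [_ _]].
  by rewrite kE => /negbTE g1 /negbTE g2; rewrite g1 g2 in ends.
have nac : ~~ padj G (x 0) (x t.+1) by rewrite adj; lia.
case/negP: (nadj_ndep ne nac); apply: ndep_path.
- by rewrite (mem_below pop) in_set2 eqxx.
- by rewrite (mem_below pop) in_set2 eqxx orbT.
- move=> i it; rewrite in_setD (mem_below pop) plemax2 negb_and negbK negb_or int // orbT /=.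
  apply: contraT => H; case: low; exists i => //; move: H; apply: contraR.
  rewrite -negb_or negbK => /orP[] h; apply/anc_setP; [exists (x 0)|exists (x t.+1)];
    by rewrite // !in_setU1 eqxx ?orbT.
- by move=> i it; have [_ ->] := unc i i.+1 isT (ltnSn i) it.
Qed.

(** Otherwise the interior avoids the conditioning set of the triple but consists of ancestors of
    [b], which is in it, and the path puts the triple in [E3]. *)
Lemma subset_E6t t : 0 < t -> Dset G P pi t = Dset G Ps pis t ->
  E6t G Ps pis t \subset E6t G P pi t.
Proof.
move=> t0 DE; apply/subsetP=> -[s [[a b] c]].
rewrite (mem_E6t (scc_popartition G) (@scc_E1 _ G)) // (mem_E6t pop E1E) // -DE -E2E -E3E.
case/and5P=> sD /eqP a0 /eqP c1 V /andP[nE]; rewrite ble_scc sD V nE a0 c1 !eqxx /= => x1b.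
have /(mem_Dset pop E1E s t0) [unc [_ mid e1 e2]] := sD.
have := sD; rewrite DE => /(scc_Dset G s t0) [_ [_ mid' _ _]].
move: nE; rewrite in_setU negb_or => /andP[_ /(nE3_ndep V)]; apply: contraR => nle.
move: (nth _ _) unc mid mid' e1 e2 x1b nle a0 c1 => x unc mid mid' e1 e2 x1b nle a0 c1.
case/and4P: V => /and3P[ab bc _] _ _ _; rewrite [X in ndep _ _ X _]a0 [X in ndep _ _ _ X]c1.
have bZ : b \in below P pi [:: blk P a; blk P b; blk P c] [set a; c].
  rewrite (mem_below pop) in_set2 plemax3 (ble_refl pop) orbT (negbTE bc) eq_sym.
  by rewrite (negbTE ab).
apply: ndep_path.
- by rewrite (mem_below pop) in_set2 a0 eqxx.
- by rewrite (mem_below pop) in_set2 c1 eqxx orbT.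
- move=> i it; rewrite in_setD; apply/andP; split.
    have /andP[_ le1] := mid i it.
    rewrite (mem_below pop) plemax3 negb_and; apply/orP; right; rewrite a0 c1.
    apply/or3P=> -[] le2; [case/negP: e1|case/negP: nle|case/negP: e2]; exact: (ble_trans pop le1).
  apply/anc_setP; exists b; first by rewrite !in_setU1 bZ !orbT.
  by have /andP[h _] := mid' i it; apply: connect_trans x1b.
- by move=> i it; have [_ ->] := unc i i.+1 isT (ltnSn i) it.
Qed.

End MinimizerScore.

Lemma lexle_cons x y (s t : seq int) :
  lexle (x :: s) (y :: t) -> (y <= x)%R -> x = y /\ lexle s t.
Proof. by move=> /= /orP[xy|/andP[/eqP-> //]] yx; lia. Qed.

Lemma eq_card_sub (T : finType) (A B : {set T}) :
  A \subset B -> #|B| <= #|A| -> A = B.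
Proof. by move=> AB BA; apply/eqP; rewrite eqEcard AB. Qed.

(** Each inclusion, valid once the earlier entries agree, meets the opposite inequality of sizes
    given by minimality, so equality propagates along the lexicographic comparison. *)
Lemma minimizer_scc n (G : rel 'I_n) P pi : is_minimizer G P pi ->
  let Ps := scc G in let pis := scc_le G in
  [/\ E1 G P pi = E1 G Ps pis, E2 G P pi = E2 G Ps pis, E3 G P pi = E3 G Ps pis,
      (forall t, 0 < t <= n - 2 -> Dset G P pi t = Dset G Ps pis t) &
      (forall t, 0 < t <= n - 2 -> E6t G P pi t = E6t G Ps pis t)].
Proof.
move=> [pop /(_ _ _ (scc_popartition G)) le] Ps pis; move: le; rewrite /score -/Ps -/pis.
have step (T : finType) (A B : {set T}) s t : B \subset A ->
    lexle ((#|A| : int) :: s) ((#|B| : int) :: t) -> A = B /\ lexle s t.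
  move=> BA /lexle_cons[|AB st]; first by have := subset_leq_card BA; lia.
  by split=> //; apply/esym/eq_card_sub => //; case: AB => ->.
case/(step _ _ _ _ _ (subset_E1 G pop)) => E1eq.
have E1E a b : (a, b) \in E1 G P pi = padj G a b by rewrite E1eq scc_E1.
case/(step _ _ _ _ _ (subset_E2 pop E1E)) => E2eq.
case/(step _ _ _ _ _ (subset_E3 pop E1E)) => E3eq.
case/(step _ _ _ _ _ (subset_E4 pop E1E E2eq E3eq)) => _ le.
have D1 := Dset1_scc pop E1E E2eq.
have [Deq le6] : (forall t, 1 < t < 2 + (n - 3) -> Dset G P pi t = Dset G Ps pis t) /\
    lexle [:: (cardE6 G P pi : int)] [:: (cardE6 G Ps pis : int)].
  suff gen m k : 1 < k ->
      lexle ([seq (- (#|Dset G P pi t| : int))%R | t <- iota k m] ++ [:: (cardE6 G P pi : int)])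
        ([seq (- (#|Dset G Ps pis t| : int))%R | t <- iota k m] ++ [:: (cardE6 G Ps pis : int)]) ->
      (forall t, 1 < t < k -> Dset G P pi t = Dset G Ps pis t) ->
      (forall t, 1 < t < k + m -> Dset G P pi t = Dset G Ps pis t) /\
      lexle [:: (cardE6 G P pi : int)] [:: (cardE6 G Ps pis : int)].
    by apply: gen le _ => // t; lia.
  elim: m k => [|m IH] k k2; first by rewrite addn0.
  rewrite [iota _ _]/= !map_cons !cat_cons => le' Dk.
  have sub : Dset G P pi k \subset Dset G Ps pis k by apply: subset_Dset.
  have [|Ek {}le'] := lexle_cons le'; first by have := subset_leq_card sub; lia.
  have Dkk : Dset G P pi k = Dset G Ps pis k by apply: eq_card_sub => //; lia.
  rewrite addnS -addSn; apply: (IH k.+1 (leqW k2) le') => t tk.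
  by have [->//|ne] := eqVneq t k; apply: Dk; lia.
have Dall t : 0 < t <= n - 2 -> Dset G P pi t = Dset G Ps pis t.
  by move=> tn; have [->//|t1] := eqVneq t 1; apply: Deq; lia.
split=> // t tn; apply/esym/eq_card_sub; first by apply: subset_E6t => //; [lia | apply: Dall].
(* Only the total size is compared; since every slice is included in its counterpart, the bound on
   the total bounds each slice. *)
have sum_le : cardE6 G P pi <= cardE6 G Ps pis.
  by move: le6 => /= /orP[|/andP[/eqP]]; lia.
have tin : t \in index_iota 1 n.-1 by rewrite mem_index_iota; lia.
move: sum_le; rewrite /cardE6 !(bigD1_seq t tin (iota_uniq _ _)) /=.
set r := \sum_(i <- _ | _) #|E6t G P pi i|; set r' := \sum_(i <- _ | _) _.
suff : r' <= r by lia.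
rewrite /r /r' big_seq_cond [X in _ <= X]big_seq_cond; apply: leq_sum => i /andP[].
rewrite mem_index_iota => ii _.
by apply/subset_leq_card/subset_E6t => //; [lia | apply: Dall; lia].
Qed.

(** * Ascending paths *)

(** [d] is the least length of an [e]-path into [A], with default 0 where there is none; hence the
    assumptions that [A] is reached. *)
Lemma geodesics (T : finType) (e : rel T) (A : pred T) :
  exists d : T -> nat,
    (forall x z, connect e x z -> A z ->
       exists y : nat -> T, [/\ y 0 = x, (forall i, i < d x -> e (y i) (y i.+1)),
         (forall i, i <= d x -> d (y i) = d x - i) & A (y (d x))]) /\
    (forall x x' z, e x x' -> connect e x' z -> A z -> d x <= (d x').+1) /\
    (forall x, A x -> d x = 0).
Proof.
pose P x k := [exists p : k.-tuple T, path e x p && A (last x p)].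
have PI x p : path e x p -> A (last x p) -> P x (size p).
  by move=> pth lst; apply/existsP; exists (in_tuple p); rewrite /= pth.
have exP x z : connect e x z -> A z -> exists k, P x k.
  by case/connectP=> p pth -> Az; exists (size p); apply: PI.
pose d x := if pselect (exists k, P x k) is left h then ex_minn h else 0.
have d_le x p : path e x p -> A (last x p) -> d x <= size p.
  move=> pth lst; rewrite /d; case: pselect => // h.
  by case: ex_minnP => k _; apply; apply: PI.
have d_path x z : connect e x z -> A z ->
    exists p, [/\ path e x p, A (last x p) & size p = d x].
  move=> xz Az; rewrite /d; case: pselect => [h|[]]; last exact: exP xz Az.
  case: ex_minnP => k /existsP[p /andP[pth lst]] _.
  by exists p; rewrite size_tuple.
exists d; split=> [x z xz Az|]; last first.
  split=> [x x' z xx' x'z Az|x Ax]; last by apply/eqP; rewrite -leqn0; apply: (d_le x [::]).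
  have [p [pth lst <-]] := d_path _ _ x'z Az.
  by apply: (d_le x (x' :: p)) => //=; rewrite xx'.
have [p [pth lst szp]] := d_path _ _ xz Az.
pose y i := nth x (x :: p) i.
have ypath i : i <= d x -> path e (y i) (drop i p) /\ last (y i) (drop i p) = last x p.
  case: i => [|i] id; first by rewrite drop0.
  have isz : i < size p by rewrite szp.
  rewrite /y /= -[in last x p](cat_take_drop i p) last_cat (drop_nth x isz) /=.
  by move: pth; rewrite -{1}(cat_take_drop i p) cat_path (drop_nth x isz) /= => /and3P[_ _].
have ytake i : i <= d x -> path e x (take i p) /\ last x (take i p) = y i.
  move=> id; split; first by move: pth; rewrite -{1}(cat_take_drop i p) cat_path => /andP[].
  rewrite (last_nth x) size_takel ?szp // /y; case: i id => //= i id.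
  by rewrite nth_take.
exists y; split=> //.
- by move=> i id; have /(pathP x)/(_ i) := pth; rewrite szp; apply.
- move=> i id; have [P1 L1] := ypath i id; have [P2 L2] := ytake i id.
  apply/eqP; rewrite eqn_leq; apply/andP; split.
    by rewrite -szp -size_drop; apply: d_le; rewrite ?L1.
  have yz : connect e (y i) (last x p) by apply/connectP; exists (drop i p).
  have [q [P3 L3 <-]] := d_path _ _ yz lst.
  have := d_le x (take i p ++ q); rewrite cat_path P2 L2 P3 last_cat L2 size_cat size_takel ?szp //.
  by move=> /(_ isT L3); lia.
- have [P1 L1] := ypath _ (leqnn (d x)).
  by move: L1; rewrite -szp drop_size /= => ->.
Qed.

Section Transfer.
Variables (T : eqType) (adj le1 le2 : rel T).
Hypothesis adjC : symmetric adj.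
Hypothesis le1_trans : transitive le1.
Hypothesis le2xx : reflexive le2.
Hypothesis le2_trans : transitive le2.
Hypothesis same_plateau : forall x j k, plateau adj le2 x j k -> plateau adj le1 x j k.

(* An ascent for [le1] along an uncovered path is one for [le2], unless [le2] has a
   summit along it; such a summit would be one for [le1] too, unless it is
   the whole cycle. *)
Lemma ascent_transfer (x : nat -> T) m : 1 < m ->
    (forall i i', i < i' <= m -> (i, i') != (0, m) ->
       x i != x i' /\ adj (x i) (x i') = (i' == i.+1)) ->
    x 0 != x m -> (forall i, 0 < i < m -> le1 (x i) (x i.+1)) ->
    ~~ le2 (x 1) (x 0) -> ~~ le2 (x 1) (x m) ->
  adj (x 0) (x m) /\ (forall i, 0 < i < m -> le2 (x 1) (x i) && le2 (x i) (x 1)).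
Proof.
move=> m1 unc x0m asc e0 em.
have [j [k [_ km [jk mid f1 f2] _]]] := summit_exists le2xx le2_trans (m1 : 0 < 1 < m) e0 em.
(* On a plateau shared by both relations the ascent would put the last interior element, hence the
   whole interior, below the right end. *)
have no_plateau : ~ uncovered adj x j k.
  move=> unc'; have [_ [_ mid1 _ /negP]] : plateau adj le1 x j k by exact: same_plateau.
  apply; have [km1|km1] := eqVneq k j.+2.
    by subst k; apply: asc; lia.
  have /andP[_ le] := mid1 k.-1 ltac:(lia); apply: le1_trans le _.
  by have := asc k.-1; rewrite prednK; [apply; lia | lia].
have [j0 kE] : j = 0 /\ k = m.
  apply: contrapT => ne; apply: no_plateau => i i' ji ii' ik; apply: unc; first lia.
  by rewrite xpair_eqE; apply/negP=> /andP[/eqP ? /eqP ?]; apply: ne; lia.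
subst j k; split=> [|i /mid]; last by rewrite andbC.
apply: contraT => nadj; case: no_plateau => i i' _ ii' im.
have [/eqP[-> ->]|ne] := boolP ((i, i') == (0, m)); last by apply: unc => //; rewrite ii'.
by rewrite (negbTE nadj); split=> //; lia.
Qed.

Variables (y : nat -> T) (r : nat).
Hypothesis r_gt0 : 0 < r.
Hypothesis y_asc : forall i, 0 < i < r -> le1 (y i) (y i.+1).
Hypothesis y_unc : uncovered adj y 1 r.

(** The ascent [y 1], ..., [y r] leaves the plateau next to an interior vertex. Interior vertices
    can be adjacent to [y 1] only, the two ends to any [y i]. *)
Definition attached (X : nat -> T) (t : nat) : Prop :=
  [/\ plateau adj le1 X 0 t.+1, summit le2 X 0 t.+1,
      (forall a i, a <= t.+1 -> 0 < i <= r -> X a != y i),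
      (forall a i, 0 < a <= t -> 1 < i <= r -> ~~ adj (X a) (y i)) &
      exists2 a, 0 < a <= t & adj (X a) (y 1) && le1 (X a) (y 1)].

Lemma attached_rev X t : attached X t -> attached (fun i => X (t.+1 - i)) t.
Proof.
have flip le : transitive le -> summit le X 0 t.+1 -> summit le (fun i => X (t.+1 - i)) 0 t.+1.
  move=> le_trans [t1 mid e1 e2]; have /andP[t1' t1''] := mid t ltac:(lia).
  rewrite /summit subn0 subnn subSS subn0; split=> //.
  - move=> i it; have /andP[a b] := mid (t.+1 - i) ltac:(lia).
    by rewrite (le_trans _ _ _ a) // (le_trans _ _ _ _ b).
  - by apply: contra e2; apply: le_trans.
  - by apply: contra e1; apply: le_trans.
case=> -[unc s1] s2 ne far [a ta near]; split.
- by split; [exact: uncovered_rev | exact: flip].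
- exact: flip.
- by move=> b i _; apply: ne; lia.
- by move=> b i bt; apply: far; lia.
- by exists (t.+1 - a); [lia | rewrite subKn //; lia].
Qed.

Hypothesis y_top : forall i, 0 < i < r -> ~~ le2 (y i) (y r).

(** Follow [X] from [X 0] to the first interior vertex adjacent to [y 1], then follow [y]. This path
    ascends for [le1] after [X 0] and has no chord except perhaps between its ends, so
    [ascent_transfer] applies. *)
Lemma attached_unlinked X t : attached X t -> ~~ le2 (X 1) (y r) ->
  (forall i, 0 < i < r -> ~~ adj (X 0) (y i)) ->
  adj (X 0) (y r) /\ (forall i, 0 < i < r -> le2 (X 1) (y i) && le2 (y i) (X 1)).
Proof.
case=> -[unc [t1 mid1 e1 _]] [_ mid2 f1 _] ne far [a0 ta0 near0] top unl.
have exl : exists a, (0 < a) && adj (X a) (y 1).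
  by exists a0; case/andP: near0 => ->; lia.
case: (ex_minnP exl) => l /andP[l0 adjl] lmin {exl}.
have lt : l <= t by have := lmin a0; case/andP: near0 => -> _; lia.
pose W i := if i <= l then X i else y (i - l).
have WX i : i <= l -> W i = X i by rewrite /W => ->.
have Wy i : l < i -> W i = y (i - l) by rewrite /W ltnNge => /negbTE->.
have W1 : W 1 = X 1 by rewrite WX.
have W0 : W 0 = X 0 by rewrite WX.
have Wr : W (l + r) = y r by rewrite Wy ?addKn //; lia.
have leXl a b : 0 < a <= t -> 0 < b <= t -> le1 (X a) (X b).
  move=> at_ bt; have /andP[h _] := mid1 a ltac:(lia); have /andP[_ h'] := mid1 b ltac:(lia).
  exact: le1_trans h h'.
have [||||||adjW eqW] := @ascent_transfer W (l + r).
- lia.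
- move=> i i' ii' nn; have [il'|il'] := leqP i' l.
    by rewrite !WX; [apply: unc; lia | lia | lia].
  have [il|il] := leqP i l; last first.
    rewrite !Wy //; have [-> ->] := @y_unc (i - l) (i' - l) ltac:(lia) ltac:(lia) ltac:(lia).
    by split=> //; lia.
  rewrite (WX i) // (Wy i') //; split; first by apply: ne; lia.
  have [i0|i0] := posnP i.
    subst i; have ir : 0 < i' - l < r by move: nn; rewrite xpair_eqE; lia.
    rewrite (negbTE (unl _ ir)); lia.
  have [i1|i1] := eqVneq i' l.+1; last by rewrite (negbTE (far _ _ _ _)) //; lia.
  subst i'; rewrite subSnn; have [->|nl] := eqVneq i l; first by rewrite adjl eqxx.
  by apply/idP/idP=> [h|]; [have := lmin i; rewrite h i0 /=; lia | lia].
- by rewrite W0 Wr; apply: ne; lia.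
- move=> i ilr; have [il|il] := ltnP i l.
    by rewrite !WX; [apply: leXl; lia | lia | lia].
  have [il'|il'] := eqVneq i l.
    subst i; rewrite WX // Wy // subSnn; case/andP: near0 => _.
    by apply: le1_trans; apply: leXl; lia.
  by rewrite !Wy ?subSn; [apply: y_asc; lia | lia | lia | lia].
- by rewrite W1 W0.
- by rewrite W1 Wr.
rewrite W0 Wr in adjW; split=> // i ir.
by have := eqW (i + l); rewrite W1 Wy ?addnK; [apply; lia | lia].
Qed.

(** Take the last [y i] adjacent to [q]. If it were not below [q] for [le2], [ascent_transfer] along
    [q], [y i], ..., [y r] would make [q] adjacent to [y r]. *)
Lemma linked_below q i0 : 0 < i0 < r -> adj q (y i0) -> ~~ adj q (y r) ->
  (forall i, 0 < i <= r -> q != y i) ->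
  exists2 i, 0 < i < r & le2 (y i) q.
Proof.
move=> i0r qi0 qr qy.
have exi : exists i, [&& 0 < i, i < r & adj q (y i)] by exists i0; rewrite qi0; lia.
have ub i : [&& 0 < i, i < r & adj q (y i)] -> i <= r by lia.
case: (ex_maxnP exi ub) => i /and3P[i_gt0 ir qi] imax.
exists i; first lia; apply: contraT => nle.
pose W a := if a is a'.+1 then y (i + a') else q.
have Wr : W (r - i).+1 = y r by rewrite /= subnKC // ltnW.
have [||||||] := @ascent_transfer W (r - i).+1.
- lia.
- case=> [|a] [|a'] //= aa' nn; last first.
    have [-> ->] := @y_unc (i + a) (i + a') ltac:(lia) ltac:(lia) ltac:(lia).
    by split=> //; lia.
  split; first by apply: qy; lia.
  case: a' aa' nn => [|a'] aa' nn; first by rewrite addn0 qi.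
  apply/negbTE/negP=> h; have := imax (i + a'.+1); rewrite h.
  have [ar|ar] := eqVneq (i + a'.+1) r; last by lia.
  by rewrite ar (negbTE qr) in h.
- by rewrite Wr; apply: qy; lia.
- by case=> // a ar /=; rewrite addnS; apply: y_asc; lia.
- by rewrite /= addn0.
- by rewrite Wr /= addn0; apply: y_top; lia.
by rewrite Wr /= (negbTE qr).
Qed.

(** If the far end touched [y] before [y r] but not [y r] itself, it would be above some [y i'],
    hence above [X 1], for [le2], which a summit forbids. If it touches [y] nowhere before [y r],
    the reversed plateau settles it. *)
Lemma attached_linked X t : attached X t -> ~~ le2 (X 1) (y r) ->
  (forall i, 0 < i < r -> ~~ adj (X 0) (y i)) -> adj (X 0) (y r) && adj (X t.+1) (y r).
Proof.
move=> at_ top unl; have [-> eqy] := attached_unlinked at_ top unl; rewrite /=.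
have [_ [_ mid2 e1 e2] ne _ _] := at_.
apply: contraT => nadj.
have [[i ir adji]|unl'] := pselect (exists2 i, 0 < i < r & adj (X t.+1) (y i)).
  have [i' ir' le] := linked_below ir adji nadj (fun i => ne _ i (leqnn _)).
  by case/negP: e2; have /andP[h _] := eqy i' ir'; apply: le2_trans h le.
have [||] := attached_unlinked (attached_rev at_).
- rewrite subSS subn0; apply: contra top; apply: le2_trans.
  by have [[_ [t1 _ _ _]] _ _ _ _] := at_; have /andP[] := mid2 t ltac:(lia).
- by move=> i ir; rewrite subn0; apply/negP=> h; apply: unl'; exists i.
by rewrite subn0 (negbTE nadj).
Qed.

End Transfer.

(** * Transfer of connections *)

Section Splice.
Variables (T : eqType) (e : rel T).

(** The default [v] of [nth] serves as the last vertex of the walk, at position [(size w).+1]; [mid]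
    replaces what lies strictly between positions [j] and [k]. *)
Lemma path_splice u v w mid j k : j < k <= (size w).+1 ->
  path e u (rcons w v) ->
  path e (nth v (u :: w) j) (rcons mid (nth v (u :: w) k)) ->
  path e u (rcons (take j w ++ mid ++ drop k.-1 w) v).
Proof.
case: k => // k; move=> jks pth pmid; have jw : j <= size w by lia.
rewrite !rcons_cat cat_path.
move: (pth); rewrite -{1}(cat_take_drop j w) rcons_cat cat_path => /andP[-> _] /=.
have -> : last u (take j w) = nth v (u :: w) j.
  rewrite (last_nth v) size_takel //; case: (j) jw => //= i iw.
  by rewrite nth_take.
have E : rcons (drop k w) v = nth v w k :: behead (rcons (drop k w) v).
  have [kw|kw] := ltnP k (size w); first by rewrite (drop_nth v kw).
  by rewrite drop_oversize //= nth_default.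
move: pth; rewrite -{1}(cat_take_drop k w) rcons_cat cat_path => /andP[_].
rewrite E /= => /andP[_ ptl].
by rewrite -cat_rcons cat_path pmid last_rcons.
Qed.

Lemma sum_splice (f : T -> nat) v w mid j i k : j < i < k -> k <= (size w).+1 ->
  \sum_(x <- mid) f x < f (nth v w i.-1) ->
  \sum_(x <- take j w ++ mid ++ drop k.-1 w) f x < \sum_(x <- w) f x.
Proof.
case: i k => [|i] [|k] /=; rewrite ?ltn0 ?andbF // => /andP[ji ik] ks lt_f.
have dE : drop j w = take (k - j) (drop j w) ++ drop k w.
  by rewrite -{1}(cat_take_drop (k - j) (drop j w)) drop_drop subnK //; lia.
rewrite -[X in _ < \sum_(x <- X) _](cat_take_drop j w) dE !big_cat /= ltn_add2l ltn_add2r.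
have iw : nth v w i \in take (k - j) (drop j w).
  have -> : nth v w i = nth v (take (k - j) (drop j w)) (i - j).
    by rewrite nth_take ?nth_drop ?subnKC //; lia.
  by rewrite mem_nth // size_takel ?size_drop; lia.
by rewrite (big_rem _ iw) /=; lia.
Qed.

Lemma path_map_iota (y : nat -> T) p q i c : e p (y i) ->
  (forall k, i <= k < i + c -> e (y k) (y k.+1)) -> e (y (i + c)) q ->
  path e p (rcons [seq y k | k <- iota i c.+1] q).
Proof.
elim: c i p => [|c IH] i p pi yk yq; first by rewrite addn0 in yq; rewrite /= pi yq.
rewrite [iota _ _]/= map_cons rcons_cons /= pi.
by apply: IH => [|k ik|]; rewrite ?addSnnS //; apply: yk; lia.
Qed.

Lemma path_rev_sym p q s : symmetric e ->
  path e q (rcons s p) -> path e p (rcons (rev s) q).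
Proof.
move=> eC; rewrite (eq_path (e' := fun z => e^~ z)) => [|a b]; last exact: eC.
by rewrite -rev_path last_rcons belast_rcons rev_cons.
Qed.

End Splice.

(** The reason for the weights [2 ^ d]: distances strictly decrease along a geodesic, so any segment
    after its first vertex costs less than that vertex. *)
Lemma sum_pow2_geo (r i c : nat) : i + c <= r -> 0 < i ->
  \sum_(k <- iota i c) 2 ^ (r - k) < 2 ^ r.
Proof.
move=> icr i0; apply: (@leq_trans (2 ^ (r - i.-1))); last by rewrite leq_exp2l //; lia.
elim: c i i0 icr => [|c IH] i i0 icr; first by rewrite big_nil expn_gt0.
rewrite big_cons; have := IH i.+1 isT ltac:(lia) => /=.
have -> : r - i.-1 = (r - i).+1 by lia.
by rewrite expnS mul2n -addnn ltn_add2l.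
Qed.

Section SeparationTransfer.
Variable n : nat.
Local Notation T := 'I_n.
Variables G1 G2 : rel T.
Hypothesis same_padj : padj G1 =2 padj G2.
Hypothesis same_plateau : forall x j k,
  plateau (padj G1) (connect G1) x j k <-> plateau (padj G1) (connect G2) x j k.
Hypothesis same_joint_child : forall a b c,
  vtriple G1 a b c -> joint_child_above G1 a b c = joint_child_above G2 a b c.
(** The information carried by [E6], for triples in neither [E2] nor [E3]. *)
Hypothesis plateau_below_imperfect : forall x j k b,
  plateau (padj G1) (connect G1) x j k -> vtriple G1 (x j) b (x k) ->
  ~~ connect G1 b (x j) -> ~~ connect G1 b (x k) ->
  ~~ joint_child_above G1 (x j) b (x k) -> connect G1 (x j.+1) b ->
  connect G2 (x j.+1) b.

Lemma connect_padj x z : connect G1 x z ->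
  connect (fun a b => padj G1 a b && connect G1 a b) x z.
Proof.
case/connectP=> p; elim: p x => [|x' p IH] x /=; first by move=> _ ->; apply: connect0.
case/andP=> xx' pth lst; have [->|ne] := eqVneq x x'; first exact: IH.
by apply: connect_trans (IH _ pth lst); apply: connect1; rewrite edge_padj // connect1.
Qed.

Section Bridge.
Variable A : {set T}.
Hypothesis A_closed : forall x y, connect G2 x y -> y \in A -> x \in A.
Local Notation B := (anc_set G1 A).
Local Notation up := (fun a b => padj G1 a b && connect G1 a b).

Lemma not_connect_closed y z : y \notin A -> z \in A -> ~~ connect G2 y z.
Proof. by move=> yA zA; apply: contra yA => yz; apply: A_closed yz zA. Qed.

Variable d : T -> nat.
Hypothesis d_geo : forall x z, connect up x z -> z \in A ->
  exists y : nat -> T, [/\ y 0 = x, (forall i, i < d x -> up (y i) (y i.+1)),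
    (forall i, i <= d x -> d (y i) = d x - i) & y (d x) \in A].
Hypothesis d_step : forall x x' z, up x x' -> connect up x' z -> z \in A -> d x <= (d x').+1.
Hypothesis d_in : forall x, x \in A -> d x = 0.

(** Before its end the geodesic avoids [A], where [d] vanishes. The last clause bounds the distance
    of any vertex that can step up onto it. *)
Lemma ascending_geodesic s : s \in B :\: A ->
  exists y : nat -> T,
    [/\ y 0 = s, 0 < d s, y (d s) \in A,
        (forall i, i <= d s -> d (y i) = d s - i) &
    [/\ (forall i, i < d s -> y i \in B :\: A),
        (forall i i', i <= i' <= d s -> connect G1 (y i) (y i')),
        (forall i, i < d s -> padj G1 (y i) (y i.+1)) &
        (forall z i, i <= d s -> padj G1 z (y i) -> connect G1 z (y i) -> d z <= (d s - i).+1)]].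
Proof.
have toA y : y \in B -> exists2 z, z \in A & connect up y z.
  by case/anc_setP=> z zA yz; exists z => //; apply: connect_padj.
case/setDP=> sB sA; have [z0 z0A sz0] := toA s sB.
have [y [y0 yasc yd yA]] := d_geo sz0 z0A; set r := d s in yasc yd yA *.
have ymono i i' : i <= i' <= r -> connect G1 (y i) (y i').
  case/andP=> ii' i'r; have: forall c, i + c <= r -> connect G1 (y i) (y (i + c)).
    elim=> [|c IHc] ic; first by rewrite addn0 connect0.
    rewrite addnS; apply: connect_trans (IHc (ltnW _)) _; first by rewrite -addnS.
    by rewrite addnS in ic; have /andP[] := yasc (i + c) ic.
  by move/(_ (i' - i)); rewrite subnKC //; apply.
have yB i : i <= r -> y i \in B.
  by move=> ir; apply/anc_setP; exists (y r) => //; apply: ymono; rewrite ir leqnn.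
exists y; split=> //.
  by rewrite lt0n; apply: contra sA => /eqP r0; rewrite -y0 -r0.
split=> //.
- move=> i ir; rewrite in_setD yB ?(ltnW ir) // andbT.
  by apply/negP=> /d_in; rewrite yd ?(ltnW ir) // => /eqP; rewrite subn_eq0 leqNgt ir.
- by move=> i /yasc/andP[].
- move=> z i ir adj le; have [t tA yt] := toA _ (yB _ ir).
  by rewrite -yd //; apply: d_step yt tA; rewrite adj.
Qed.

Lemma geodesic_segment (y : nat -> T) r i c p q :
    (forall k, k < r -> y k \in B :\: A) -> (forall k, k < r -> padj G1 (y k) (y k.+1)) ->
    (forall k, k <= r -> d (y k) = r - k) ->
    0 < i -> i + c < r -> padj G1 p (y i) -> padj G1 q (y (i + c)) ->
  let mid := [seq y k | k <- iota i c.+1] in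
  [/\ all (mem (B :\: A)) mid, path (padj G1) p (rcons mid q) &
      \sum_(z <- mid) 2 ^ d z < 2 ^ r].
Proof.
move=> yBA yadj yd i0 icr pi qi; split.
- by apply/allP=> _ /mapP[k kin ->]; apply: yBA; move: kin; rewrite mem_iota; lia.
- apply: path_map_iota => //; last by rewrite padjC.
  by move=> k ik; apply: yadj; lia.
- rewrite big_map (eq_big_seq (fun k => 2 ^ (r - k))) => [|k].
    by apply: sum_pow2_geo => //; lia.
  by rewrite mem_iota => ik; rewrite yd //; lia.
Qed.

(* Here [mid] is part of a geodesic from the plateau vertex [X a] nearest to [A], and [z] is
   the end of that geodesic. *)
Lemma plateau_bypass X t :
    plateau (padj G1) (connect G1) X 0 t.+1 -> summit (connect G2) X 0 t.+1 ->
    (forall a, 0 < a <= t -> X a \in B :\: A) ->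
  (exists mid a, [/\ 0 < a <= t, all (mem (B :\: A)) mid,
     path (padj G1) (X 0) (rcons mid (X t.+1)) &
     \sum_(z <- mid) 2 ^ d z < 2 ^ d (X a)]) \/
  (exists2 z, z \in A & [&& padj G1 (X 0) z, padj G1 (X t.+1) z & connect G1 (X 1) z]).
Proof.
move=> pl1 s2 XBA; have [unc [t1 mid1 e1 e2]] := pl1.
have [a0 a0t a0min] : exists2 a, 0 < a <= t & forall i, 0 < i <= t -> d (X a) <= d (X i).
  have exr : exists r, has (fun i => d (X i) == r) (iota 1 t).
    by exists (d (X 1)); apply/hasP; exists 1; [rewrite mem_iota; lia | exact: eqxx].
  case: (ex_minnP exr) => r /hasP[a]; rewrite mem_iota => ajk /eqP <- rmin.
  exists a; first by lia.
  by move=> i ijk; apply: rmin; apply/hasP; exists i => //; rewrite mem_iota; lia.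
have [y [y0 r0 yA yd [yBA ymono yadj ynear]]] := ascending_geodesic (XBA _ a0t).
set r := d (X a0) in r0 yA yd yBA ymono yadj ynear *.
have yunc : uncovered (padj G1) y 1 r.
  move=> i i' i1 ii' i'r; have ir := ltnW (leq_trans ii' i'r).
  split; first by apply/eqP=> e; have := yd i ir; rewrite e yd //; lia.
  have [->|ne] := eqVneq i' i.+1; first by rewrite yadj //; lia.
  apply/negbTE/negP=> adj; have := ynear _ _ i'r adj (ymono _ _ _).
  by rewrite yd // (ltnW ii') i'r => /(_ isT); lia.
have Xa0 a : 0 < a <= t -> connect G1 (X a) (X a0).
  move=> /mid1 /andP[h _]; have /andP[_ h'] := mid1 _ a0t.
  exact: connect_trans h h'.
have t_gt0 : 0 < 1 <= t by [].
(* An interior vertex lying on [y], or adjacent to it beyond [y 1], would contradict the choice of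
   [X a0] as nearest to [A]; an end lying on [y] would be a descendant of the interior. *)
have att : attached (padj G1) (connect G1) (connect G2) y r X t.
  split=> //.
  - move=> a i at_ ir; apply/eqP=> e.
    have le_y : connect G1 (X 1) (y i).
      by apply: connect_trans (Xa0 _ t_gt0) _; rewrite -y0; apply: ymono; case/andP: ir.
    have [a_0|a_0] := posnP a; first by case/negP: e1; rewrite a_0 in e; rewrite e.
    have [a_t|a_t] := eqVneq a t.+1; first by case/negP: e2; rewrite a_t in e; rewrite e.
    by have := a0min a ltac:(lia); rewrite e yd -/r; lia.
  - move=> a i at_ ir; apply/negP=> adj; have i_le : i <= r by case/andP: ir.
    have le_y : connect G1 (X a) (y i).
      by apply: connect_trans (Xa0 _ at_) _; rewrite -y0; apply: ymono.
    by have := ynear _ _ i_le adj le_y; have := a0min a at_; rewrite -/r; lia.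
  - exists a0 => //; rewrite -y0 yadj //=; apply: ymono; exact: r0.
have top a : 0 < a <= t -> ~~ connect G2 (X a) (y r).
  by move=> /XBA /setDP[_ ?]; apply: not_connect_closed.
have ytop i : 0 < i < r -> ~~ connect G2 (y i) (y r).
  by case/andP=> _ /yBA /setDP[_ ?]; apply: not_connect_closed.
have linked X' : attached (padj G1) (connect G1) (connect G2) y r X' t ->
    ~~ connect G2 (X' 1) (y r) -> (forall i, 0 < i < r -> ~~ padj G1 (X' 0) (y i)) ->
    padj G1 (X' 0) (y r) && padj G1 (X' t.+1) (y r).
  apply: (attached_linked (@padjC _ G1) (@connect_trans _ G1) (connect0 G2) (@connect_trans _ G2)) => //.
  - by move=> x j k /same_plateau.
  - by move=> i /andP[_ ir]; apply: ymono; rewrite leqnSn.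
have final : padj G1 (X 0) (y r) && padj G1 (X t.+1) (y r) ->
    exists2 z, z \in A & [&& padj G1 (X 0) z, padj G1 (X t.+1) z & connect G1 (X 1) z].
  move=> /andP[h0 h1]; exists (y r) => //; rewrite h0 h1 /=.
  by apply: connect_trans (Xa0 _ t_gt0) _; rewrite -y0 ymono // leqnn.
(* If both ends touch the geodesic strictly before [y r], the segment between the contacts is the
   bypass; otherwise [attached_linked] applies to the plateau or its reversal. *)
have [[i ir adji]|unl] := pselect (exists2 i, 0 < i < r & padj G1 (X 0) (y i)); last first.
  right; apply: final; apply: linked => //; first exact: top.
  by move=> i ir; apply/negP=> h; apply: unl; exists i.
have [[i' ir' adji']|unl] := pselect (exists2 i, 0 < i < r & padj G1 (X t.+1) (y i)); last first.
  right; apply: final.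
  have att_rev := attached_rev (@padjC _ G1) (@connect_trans _ G1) (@connect_trans _ G2) r0 att.
  have := linked _ att_rev.
  rewrite subSS !subn0 subnn andbC; apply; first by apply: top; rewrite leqnn andbT.
  by move=> i0 ir0; apply/negP=> h; apply: unl; exists i0.
left.
have [ii'|ii'] := leqP i i'.
  have [] := geodesic_segment yBA yadj yd (i := i) (c := i' - i) (p := X 0) (q := X t.+1);
    rewrite ?subnKC //; [lia | lia |].
  by move=> mBA mp ms; exists [seq y k | k <- iota i (i' - i).+1], a0.
have [] := geodesic_segment yBA yadj yd (i := i') (c := i - i') (p := X t.+1) (q := X 0);
  rewrite ?subnKC //; [lia | lia | lia | lia |].
move=> mBA mp ms; exists (rev [seq y k | k <- iota i' (i - i').+1]), a0; split=> //.
- by rewrite all_rev.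
- by apply: path_rev_sym => //; apply: padjC.
- by rewrite (perm_big _ (permEl (perm_rev _))).
Qed.

(** Were there no common child of the ends ancestral to [z], [E6] would make [x j.+1] an ancestor of
    [z] in [G2], hence a member of [A]. By [E3] such a child exists in [G2] as well, and it lies in
    [A]. *)
Lemma common_neighbour_moral x j k z :
    plateau (padj G1) (connect G1) x j k -> x j.+1 \notin A -> z \in A ->
    padj G1 (x j) z -> padj G1 (x k) z -> connect G1 (x j.+1) z ->
  [/\ x j \in A, x k \in A & moral G2 A (x j) (x k)].
Proof.
move=> /[dup] pl [unc [jk mid e1 e2]] xA zA jz kz xz.
have njk : x j != x k /\ padj G1 (x j) (x k) = (k == j.+1) by apply: unc => //; lia.
have V : vtriple G1 (x j) z (x k).
  rewrite /vtriple /distinct3 (andP jz).1 jz kz njk.1 njk.2 eq_sym (andP kz).1 /=; lia.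
have nz t : ~~ connect G1 (x j.+1) t -> ~~ connect G1 z t.
  by apply: contra; apply: connect_trans.
have [jc|njc] := boolP (joint_child_above G1 (x j) z (x k)); last first.
  have := plateau_below_imperfect pl V (nz _ e1) (nz _ e2) njc xz.
  by rewrite (negbTE (not_connect_closed xA zA)).
move: jc; rewrite same_joint_child // => /existsP[c /and3P[jc kc cz]].
have cA : c \in A := A_closed cz zA.
split; [exact: A_closed (connect1 jc) cA | exact: A_closed (connect1 kc) cA |].
by apply/or3P; apply: Or33; apply/exists_inP; exists c => //; rewrite jc.
Qed.

(** By induction on the cost, every cheaper bridge is already excluded, so [w] can be treated as a
    cheapest one. *)
Lemma no_bridge u v w : u \in A -> v \in A -> u != v -> ~~ moral G2 A u v ->
  all (mem (B :\: A)) w -> ~~ path (padj G1) u (rcons w v).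
Proof.
move=> uA vA uv nuv.
have [N] := ubnP (\sum_(x <- w) 2 ^ d x); elim: N w => // N IH w; rewrite ltnS => wN wBA.
apply/negP=> pth.
have nadj : ~~ padj G1 u v.
  by apply: contra nuv; rewrite same_padj => /padj_moral; apply.
pose x i := nth v (u :: w) i; pose m := (size w).+1.
have x0 : x 0 = u by [].
have xm : x m = v by rewrite /x /= nth_default.
have xBA i : 0 < i < m -> x i \in B :\: A.
  by case: i => // i iw; rewrite /x /=; apply: (allP wBA); apply: mem_nth.
have xadj i : i < m -> padj G1 (x i) (x i.+1).
  move=> im; have /(pathP v)/(_ i) := pth; rewrite size_rcons => /(_ im).
  have nr s k : nth v (rcons s v) k = nth v s k.
    by rewrite nth_rcons; case: ltnP => // h; rewrite nth_default // if_same.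
  by rewrite -rcons_cons !nr.
have splice mid j i k : j < i < k -> k <= m -> all (mem (B :\: A)) mid ->
    path (padj G1) (x j) (rcons mid (x k)) -> 2 ^ d (x i) <= \sum_(z <- mid) 2 ^ d z.
  move=> jik km midBA midp; rewrite leqNgt; apply/negP=> lt.
  case: i jik lt => [|i] jik lt; first by rewrite ltn0 in jik.
  have lt' := sum_splice (f := fun z => 2 ^ d z) (v := v) jik km lt.
  have pth' : path (padj G1) u (rcons (take j w ++ mid ++ drop k.-1 w) v).
    apply: (path_splice _ pth midp); case/andP: jik => ji ik.
    by rewrite km andbT (leq_trans ji (ltnW ik)).
  have := IH _ (leq_trans lt' wN); rewrite pth' => no; apply/notF/no.
  rewrite !all_cat midBA /=.
  by apply/andP; split; apply/allP=> z; [move/mem_take|move/mem_drop]; apply: (allP wBA).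
clearbody x m; clear N IH wN wBA w pth.
(* A chord is an empty detour, of cost 0. *)
have chord i k : i.+1 < k <= m -> ~~ padj G1 (x i) (x k).
  case/andP=> ik km; apply/negP=> h; have := splice [::] i i.+1 k.
  by rewrite ltnSn ik km /= h big_nil leqNgt expn_gt0 => /(_ isT isT isT isT).
have xA i : 0 < i < m -> x i \notin A by move=> /xBA /setDP[].
have unc : uncovered (padj G1) x 0 m.
  move=> i i' _ ii' im; split; last first.
    have [->|ne] := eqVneq i' i.+1; first by rewrite xadj // (leq_trans ii').
    by apply/negbTE/chord; rewrite im andbT ltn_neqAle eq_sym ne.
  (* A repeated vertex would have a chord to the successor of its second visit; the last vertex [v]
     is not repeated, as the interior avoids [A]. *)
  apply/eqP=> e; have [i'm|i'm] := eqVneq i' m.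
    subst i'; rewrite xm in e; have [i0|i0] := posnP i; first by subst i; rewrite -e x0 eqxx in uv.
    by have := xA i; rewrite e vA i0 ii' => /(_ isT).
  have i'm' : i' < m by rewrite ltn_neqAle i'm.
  by have := chord i i'.+1; rewrite e xadj // ltnS ii' i'm' => /(_ isT).
have m2 : 1 < m.
  case: (m) xm xadj => [|[|//]] xm xadj; first by rewrite -x0 xm eqxx in uv.
  by have := xadj 0 isT; rewrite x0 xm (negbTE nadj).
have x1A : x 1 \notin A by apply: xA.
have [j [k [_ km s2 _]]] : exists j k, [/\ 0 <= j, k <= m, summit (connect G2) x j k &
    forall i, j < i < k -> connect G2 (x 1) (x i)].
  apply: (summit_exists (c := 1)); [exact: connect0 | exact: connect_trans | exact: m2| |].
    by rewrite x0 not_connect_closed.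
  by rewrite xm not_connect_closed.
have pl2 : plateau (padj G1) (connect G2) x j k by split=> //; apply: uncoveredS unc.
have pl1 := (same_plateau x j k).2 pl2; have jk : j.+1 < k by case: s2.
pose t := k - j.+1; have tE : t.+1 + j = k by rewrite /t; lia.
have inX a : 0 < a <= t -> j < a + j < k.
  by rewrite -tE => at_; rewrite ltn_add2r ltnS -[j in X in X && _]add0n ltn_add2r.
have [|||[mid [a [at_ midBA midp lt]]]|[z zA /and3P[jz kz xz]]] :=
    @plateau_bypass (fun i => x (i + j)) t.
- by apply/(plateau_shift _ _ x 0 t.+1 j); rewrite add0n tE.
- by apply/(summit_shift _ x 0 t.+1 j); rewrite add0n tE.
- by move=> a /inX /andP[ja ak]; apply: xBA; rewrite (leq_ltn_trans (leq0n _) ja) (leq_trans ak km).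
- by move: lt; rewrite /= tE in midp *; rewrite ltnNge (splice mid j (a + j) k) // inX.
rewrite /= tE in kz xz; have xjA : x j.+1 \notin A by apply: xA; rewrite (leq_trans jk km).
have [jA kA mor] := common_neighbour_moral pl1 xjA zA jz kz xz.
(* Interior vertices are outside [A], so a stretch with both ends in [A] is the whole walk. *)
have j0 : j = 0.
  apply/eqP; rewrite -leqn0 leqNgt; apply: contraL jA => j_gt0; apply: xA.
  by rewrite j_gt0 (leq_trans (ltn_trans (ltnSn j) jk) km).
have kE : k = m.
  apply/eqP; rewrite eqn_leq km leqNgt; apply: contraL kA => k_lt; apply: xA.
  by rewrite k_lt andbT (leq_ltn_trans (leq0n _) jk).
by rewrite j0 kE x0 xm (negbTE nuv) in mor.
Qed.

End Bridge.

Lemma bridge_moral (A : {set T}) u v w :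
    (forall x y, connect G2 x y -> y \in A -> x \in A) -> u \in A -> v \in A ->
    all (mem (anc_set G1 A :\: A)) w -> path (padj G1) u (rcons w v) ->
  u = v \/ moral G2 A u v.
Proof.
move=> clA uA vA wBA pth; have [|uv] := eqVneq u v; [by left|right].
have [d [geo [d_step d_in]]] := geodesics (fun a b => padj G1 a b && connect G1 a b) (mem A).
by apply: contraLR pth => nuv; apply: (no_bridge clA geo d_step d_in).
Qed.

Lemma dconnected_transfer (Z : {set T}) (a b : T) : a \notin Z -> b \notin Z ->
  dconnected G1 Z a b -> dconnected G2 Z a b.
Proof.
move=> aZ bZ; rewrite !dconnected_moral //.
set A1 := anc_set G1 _; set A := anc_set G2 _.
have clA x y : connect G2 x y -> y \in A -> x \in A by apply: anc_set_closed.
have A1B : A1 \subset anc_set G1 A by apply/anc_setS/subsetP/mem_anc_set.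
case/connectP=> p pth lst.
(* Along a moral path of [G1], the last vertex met in [A] is reached in [G2]. *)
suff inv q : path (moral_off G1 A1 Z) a q -> exists c w,
    [/\ connect (moral_off G2 A Z) a c, c \in A :\: Z, all (mem (anc_set G1 A :\: A)) w,
        path (padj G1) c w & last c w = last a q].
  have [c [w [ac _ wBA _ lw]]] := inv p pth; rewrite -lst in lw.
  have bA : b \in A by rewrite mem_anc_set // !inE eqxx orbT.
  case/lastP: w wBA lw => [_ /= <- //|w x]; rewrite last_rcons all_rcons => /andP[/setDP[_ xA] _] xb.
  by rewrite xb bA in xA.
elim/last_ind: q => [_|q y IH].
  exists a, [::]; split=> //.
  by rewrite in_setD aZ mem_anc_set // !inE eqxx.
rewrite rcons_path last_rcons => /andP[/IH[c [w [ac cAZ wBA cw lw]]] /and3P[_ yA1 xy]] {IH}.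
have [[yA1' yZ] [cA cZ]] := (setDP yA1, setDP cAZ); rewrite -lw in xy.
(* Steps outside [A] accumulate in [w]; on the return to [A], [bridge_moral] replaces them by one
   moral edge of [G2]. *)
have bridge w' : all (mem (anc_set G1 A :\: A)) w' -> path (padj G1) c (rcons w' y) ->
    exists c w, [/\ connect (moral_off G2 A Z) a c, c \in A :\: Z,
      all (mem (anc_set G1 A :\: A)) w, path (padj G1) c w & last c w = y].
  move=> w'BA pw'; have [yA|yA] := boolP (y \in A); last first.
    exists c, (rcons w' y); split=> //; last by rewrite last_rcons.
    by rewrite all_rcons w'BA andbT /= in_setD yA (subsetP A1B).
  exists y, [::]; split=> //; last by rewrite in_setD yA yZ.
  case: (bridge_moral clA cA yA w'BA pw') => [<- //|mor].
  by apply: connect_trans ac (connect1 _); apply/and3P; split=> //; rewrite in_setD yA yZ.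
have [xy_eq|xNy] := eqVneq (last c w) y; first by exists c, w; rewrite xy_eq.
have [xady|nxady] := boolP (padj G1 (last c w) y).
  by apply: (bridge w) => //; rewrite rcons_path cw.
case/or3P: xy => [h|h|/exists_inP[e eA1 /andP[xe ye]]].
- by rewrite edge_padj in nxady.
- by rewrite padjC edge_padj // eq_sym in nxady.
have xe_ne : last c w != e.
  by apply: contraNneq nxady => xE; rewrite padjC edge_padj ?[y == _]eq_sym // xE.
have ye_ne : y != e by apply: contraNneq nxady => yE; rewrite edge_padj // yE.
have xepadj : padj G1 (last c w) e by rewrite edge_padj.
have yepadj : padj G1 y e by rewrite edge_padj.
have [eA|eA] := boolP (e \in A); last first.
  apply: (bridge (rcons w e)); last by rewrite !rcons_path cw last_rcons xepadj padjC.
  by rewrite all_rcons wBA andbT /= in_setD eA (subsetP A1B).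
have V : vtriple G1 (last c w) e y.
  by rewrite /vtriple /distinct3 xe_ne [e == y]eq_sym ye_ne xNy xepadj yepadj.
(* The child [e] is its own witness in [G1]; the witness [e'] in [G2] lies in [A] and marries the
   same two vertices. *)
have : joint_child_above G1 (last c w) e y.
  by apply/existsP; exists e; rewrite xe ye connect0.
rewrite same_joint_child // => /existsP[e' /and3P[xe' ye' e'e]].
have e'A : e' \in A := clA _ _ e'e eA.
have xA : last c w \in A := clA _ _ (connect1 xe') e'A.
have yA : y \in A := clA _ _ (connect1 ye') e'A.
exists y, [::]; split=> //; last by rewrite in_setD yA yZ.
(* The last vertex of the pending stretch is in [A], so the stretch is empty and that vertex is
   [c]. *)
case/lastP: w wBA xA xe' {lw cw xNy nxady xe xe_ne xepadj V bridge} => [_ /= _ xe'|w x].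
  apply: connect_trans ac (connect1 _); apply/and3P; split=> //; first by rewrite in_setD yA yZ.
  by apply/or3P; apply: Or33; apply/exists_inP; exists e'; rewrite ?xe'.
by rewrite all_rcons last_rcons => /andP[/setDP[_ /negP]].
Qed.

End SeparationTransfer.

(** * From equal score data to Markov equivalence *)

Lemma uncovered_card n (adj : rel 'I_n) x j k : uncovered adj x j k -> k - j < n.
Proof.
move=> unc; have [kj|jk] := leqP k j; first by rewrite (eqP kj) (leq_ltn_trans _ (ltn_ord (x 0))).
have ne (i i' : nat) : i < i' -> i' < (k - j).+1 -> x (i + j) != x (i' + j).
  by move=> ii' i'k; have [|||] := unc (i + j) (i' + j); lia.
have inj : injective (fun i : 'I_(k - j).+1 => x (i + j)).
  move=> i i' e; case: (ltngtP i i') => [lt|lt|/val_inj //].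
    by have := ne _ _ lt (ltn_ord i'); rewrite e eqxx.
  by have := ne _ _ lt (ltn_ord i); rewrite e eqxx.
by have := leq_card _ inj; rewrite !card_ord.
Qed.

Lemma plateau_eq_adj (T : eqType) (adj adj' le : rel T) x j k :
  adj =2 adj' -> plateau adj le x j k -> plateau adj' le x j k.
Proof.
by move=> E [unc s]; split=> // i i' ji ii' ik; rewrite -E; apply: unc.
Qed.

Section SameData.
Variables (n : nat) (G1 G2 : rel 'I_n).
Hypothesis same_padj : padj G1 =2 padj G2.

Lemma same_vtriple a b c : vtriple G1 a b c = vtriple G2 a b c.
Proof. by rewrite /vtriple !same_padj. Qed.

(** The vertices of an uncovered path are distinct, so [t] stays in the range where the data
    agree. *)
Lemma scc_plateau_transfer (x : nat -> 'I_n) j k :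
    (forall t, 0 < t <= n - 2 ->
       Dset G1 (scc G1) (scc_le G1) t = Dset G2 (scc G2) (scc_le G2) t) ->
  plateau (padj G1) (connect G1) x j k <-> plateau (padj G1) (connect G2) x j k.
Proof.
move=> same_D.
have kE : j.+1 < k -> (k - j.+1).+1 + j = k by lia.
have tn (adj : rel 'I_n) : j.+1 < k -> uncovered adj x j k -> 0 < k - j.+1 <= n - 2.
  by move=> jk /uncovered_card; lia.
split=> [pl|/(plateau_eq_adj same_padj) pl]; have [unc [jk _ _ _]] := pl;
  have /andP[t0 tn'] := tn _ jk unc; have eqD := same_D _ (tn _ jk unc);
  move: pl; rewrite -(kE jk).
  move=> /(scc_Dset_mkseq G1 x j t0); rewrite eqD => /(scc_Dset_mkseq G2 x j t0).
  by apply: plateau_eq_adj => a b; rewrite same_padj.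
by move=> /(scc_Dset_mkseq G2 x j t0); rewrite -eqD => /(scc_Dset_mkseq G1 x j t0).
Qed.

End SameData.

Lemma same_joint_child n (G1 G2 : rel 'I_n) :
    padj G1 =2 padj G2 -> E3 G1 (scc G1) (scc_le G1) = E3 G2 (scc G2) (scc_le G2) ->
  forall a b c, vtriple G1 a b c -> joint_child_above G1 a b c = joint_child_above G2 a b c.
Proof.
move=> same_padj same_E3 a b c V; have := scc_E3 G1 a b c.
by rewrite same_E3 scc_E3 -(same_vtriple same_padj) V.
Qed.

(** The hypotheses put the path and the triple in [E6t] for [G1]; the order condition of [E6t] for
    [G2] is the conclusion. *)
Lemma scc_plateau_below n (G1 G2 : rel 'I_n) (x : nat -> 'I_n) j k b :
    padj G1 =2 padj G2 -> E2 G1 (scc G1) (scc_le G1) = E2 G2 (scc G2) (scc_le G2) ->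
    E3 G1 (scc G1) (scc_le G1) = E3 G2 (scc G2) (scc_le G2) ->
    (forall t, 0 < t <= n - 2 ->
       E6t G1 (scc G1) (scc_le G1) t = E6t G2 (scc G2) (scc_le G2) t) ->
    plateau (padj G1) (connect G1) x j k -> vtriple G1 (x j) b (x k) ->
    ~~ connect G1 b (x j) -> ~~ connect G1 b (x k) ->
    ~~ joint_child_above G1 (x j) b (x k) -> connect G1 (x j.+1) b ->
  connect G2 (x j.+1) b.
Proof.
move=> same_padj same_E2 same_E3 same_E6 pl V nj nk njc le.
have [unc [jk _ _ _]] := pl; have tn := uncovered_card unc.
have [t tE] : exists t, k = t.+1 + j by exists (k - j.+1); lia.
have t0 : 0 < t by lia.
have {tn} tn : 0 < t <= n - 2 by lia.
subst k; have sD := introT (scc_Dset_mkseq G1 x j t0) pl.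
move: sD; set s := [tuple of _] => sD.
have sE i : i <= t.+1 -> nth (thead s) s i = x (i + j).
  move=> it; rewrite (set_nth_default (x 0)) ?size_tuple //.
  exact: (@nth_mkseq _ (x 0) (fun i => x (i + j)) t.+2 i it).
have : (s, (x j, b, x (t.+1 + j))) \in E6t G1 (scc G1) (scc_le G1) t.
  rewrite (mem_E6t (scc_popartition G1) (scc_E1 G1)) // sD !sE // !eqxx V ble_scc le !andbT /=.
  rewrite in_setU negb_or scc_E3 (negbTE njc) andbF andbT.
  by rewrite (mem_E2 (scc_E1 G1)) !ble_scc (negbTE nj) (negbTE nk) andbF.
rewrite same_E6 // (mem_E6t (scc_popartition G2) (scc_E1 G2)) //.
by case/and5P=> _ _ _ _ /andP[_]; rewrite sE // ble_scc.
Qed.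

Lemma same_score_data_dconnected n (G1 G2 : rel 'I_n) P pi :
    is_minimizer G1 P pi -> is_minimizer G2 P pi -> same_score_data G1 G2 P pi ->
  forall (Z : {set 'I_n}) a b, a \notin Z -> b \notin Z ->
    dconnected G1 Z a b -> dconnected G2 Z a b.
Proof.
move=> /minimizer_scc[E1a E2a E3a Da E6a] /minimizer_scc[E1b E2b E3b Db E6b].
case=> -[E1c E2c] E3c _ Dc E6c.
have same_padj : padj G1 =2 padj G2 by move=> a b; rewrite -!scc_E1 -E1a E1c E1b.
have same_E2 := etrans (esym E2a) (etrans E2c E2b).
have same_E3 := etrans (esym E3a) (etrans E3c E3b).
have same_D t (tn : 0 < t <= n - 2) := etrans (esym (Da t tn)) (etrans (Dc t tn) (Db t tn)).
have same_E6 t (tn : 0 < t <= n - 2) := etrans (esym (E6a t tn)) (etrans (E6c t tn) (E6b t tn)).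
apply: dconnected_transfer.
- exact: same_padj.
- by move=> x j k; apply: scc_plateau_transfer.
- exact: same_joint_child.
- by move=> x j k b; apply: scc_plateau_below.
Qed.

Lemma same_score_data_sym n (G1 G2 : rel 'I_n) P pi :
  same_score_data G1 G2 P pi -> same_score_data G2 G1 P pi.
Proof.
by case=> -[e1 e2] e3 e4 eD e6; split; [split| | |move=> t /eD|move=> t /e6]; symmetry.
Qed.

Theorem theorem3p3 (n : nat) (hn : 1 <= n) (G1 G2 : rel 'I_n)
    (P : {set {set 'I_n}}) (pi : {set ({set 'I_n} * {set 'I_n})}) :
  is_minimizer G1 P pi -> is_minimizer G2 P pi ->
  same_score_data G1 G2 P pi ->
  markov_equiv G1 G2.
Proof.
move=> m1 m2 same a b Z _ aZ bZ; split=> nd dc; apply: nd.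
  exact: (same_score_data_dconnected m2 m1 (same_score_data_sym same)) dc.
exact: (same_score_data_dconnected m1 m2 same) dc.
Qed.
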